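(* Let $a,b,c,d,e\in\mathbb{R}$ with $b\neq 0$ and let $\mu\geq -1/2$. If $f\in L^1_\mu(\mathbb{R})\cap L^2_\mu(\mathbb{R})$, then its quadratic-phase Dunkl transform $\mathcal{D}^{a,b,c}_{d,e,\mu}[f]$ belongs to $L^2_\mu(\mathbb{R})$, and $$\left\|\mathcal{D}^{a,b,c}_{d,e,\mu}[f]\right\|_{\mu,2}=\|f\|_{\mu,2}.$$
   Context: For $\mu\ge -1/2$ and $1\le p<\infty$, $L^p_\mu(\mathbb{R})$ is the space of measurable $f:\mathbb{R}\to\mathbb{C}$ with $\|f\|_{\mu,p}=\left(\int_{\mathbb{R}}|f(v)|^p|v|^{2\mu+1}dv\right)^{1/p}<\infty$. Put $c_\mu=\frac{1}{2^{\mu+1}\Gamma(\mu+1)}$. The normalized spherical Bessel function is $j_\mu(z)=\Gamma(\mu+1)\sum_{n=0}^{\infty}\frac{(-1)^n (z/2)^{2n}}{n!\,\Gamma(n+\mu+1)}$, and the Dunkl kernel is $E_\mu(iw,v)=j_\mu(wv)+\frac{iwv}{2(\mu+1)}\,j_{\mu+1}(wv)$ for $w,v\in\mathbb{R}$. For real $a,b,c,d,e$ with $b\neq0$, the quadratic-phase Dunkl kernel is $\Psi^{a,b,c}_{d,e,\mu}(w,v)=e^{-i(av^2+cw^2+dv+ew)}E_\mu(-iw/b,v)$, and the quadratic-phase Dunkl transform of $f\in L^1_\mu(\mathbb{R})$ is defined by the integral $\mathcal{D}^{a,b,c}_{d,e,\mu}[f](w)=\frac{c_\mu}{(ib)^{\mu+1}}\int_{\mathbb{R}}\Psi^{a,b,c}_{d,e,\mu}(w,v)f(v)|v|^{2\mu+1}dv$.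 Complex powers are taken with the principal branch. *)

(* Defs.v *)
From HB Require Import structures.
From mathcomp Require Import all_boot all_order all_algebra.
From mathcomp Require Import all_classical all_reals all_analysis.
From mathcomp Require Import complex.

Set Implicit Arguments.
Unset Strict Implicit.
Unset Printing Implicit Defensive.

Import Order.TTheory GRing.Theory Num.Theory.
Import numFieldNormedType.Exports.

Local Open Scope classical_set_scope.
Local Open Scope ring_scope.
Local Open Scope complex_scope.

Definition cexp (R : realType) (z : R[i]) : R[i] :=
  (expR (complex.Re z))%:C * (cos (complex.Im z) +i* sin (complex.Im z)).

(* Principal argument, in ]-pi, pi] for z != 0. *)
Definition carg (R : realType) (z : R[i]) : R :=
  let t := acos (complex.Re z / Normc.normc z) in
  if 0 <= complex.Im z then t else - t.

Definition clog (R : realType) (z : R[i]) : R[i] := ln (Normc.normc z) +i* carg z.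

(* Principal branch of z ^ s; the value at z = 0 follows powR. *)
Definition cpow (R : realType) (z s : R[i]) : R[i] :=
  if z == 0 then (s == 0)%:R else cexp (s * clog z).

(* Euler's integral: the Gamma function on the positive reals. *)
Definition Gamma (R : realType) (x : R) : R :=
  \int[@lebesgue_measure R]_(t in `]0, +oo[) (t `^ (x - 1) * expR (- t)).

(* Borel measurability for the identification of R[i] with R * R. *)
Definition cmeasurable (R : realType) (f : R -> R[i]) : Prop :=
  measurable_fun [set: R] (fun v => complex.Re (f v)) /\
  measurable_fun [set: R] (fun v => complex.Im (f v)).

Definition cintegral (R : realType) (f : R -> R[i]) : R[i] :=
  (\int[@lebesgue_measure R]_v complex.Re (f v)) +i*
  (\int[@lebesgue_measure R]_v complex.Im (f v)).

Definition Lmu_norm (R : realType) (mu p : R) (f : R -> R[i]) : \bar R :=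
  ((\int[@lebesgue_measure R]_v
     (Normc.normc (f v) `^ p * `|v| `^ (2 * mu + 1))%:E) `^ p^-1)%E.

Definition in_Lmu (R : realType) (mu p : R) (f : R -> R[i]) : Prop :=
  cmeasurable f /\ (Lmu_norm mu p f < +oo)%E.

Definition c_mu (R : realType) (mu : R) : R :=
  1 / (2 `^ (mu + 1) * Gamma (mu + 1)).

(* Only real arguments are needed; there the series has real terms. *)
Definition bessel_j (R : realType) (mu z : R) : R :=
  Gamma (mu + 1) *
  limn (series (fun n : nat =>
    (- 1) ^+ n * (z / 2) ^+ (2 * n) / (n`!%:R * Gamma (n%:R + mu + 1)))).

(* dunkl_kernel mu w v is E_mu(i w, v): the factor i is built in, so that
   E_mu(- i w / b, v) is dunkl_kernel mu (- w / b) v. *)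
Definition dunkl_kernel (R : realType) (mu w v : R) : R[i] :=
  (bessel_j mu (w * v))%:C +
  'i * (w * v)%:C / (2 * (mu + 1))%:C * (bessel_j (mu + 1) (w * v))%:C.

Definition qpd_kernel (R : realType) (a b c d e mu w v : R) : R[i] :=
  cexp (- 'i * (a * v ^+ 2 + c * w ^+ 2 + d * v + e * w)%:C) *
  dunkl_kernel mu (- w / b) v.

Definition qpd_transform (R : realType) (a b c d e mu : R) (f : R -> R[i])
    (w : R) : R[i] :=
  (c_mu mu)%:C / cpow ('i * b%:C) (mu + 1)%:C *
  cintegral (fun v =>
    qpd_kernel a b c d e mu w v * f v * (`|v| `^ (2 * mu + 1))%:C).

(* Main.v *)
Require Import Defs.
From mathcomp Require Import all_boot all_order all_algebra.
From mathcomp Require Import all_classical all_reals all_analysis.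
From mathcomp Require Import complex measurable_realfun.
From mathcomp Require Import ring lra.

Import Order.TTheory GRing.Theory Num.Theory.
Import numFieldNormedType.Exports.

Local Open Scope classical_set_scope.
Local Open Scope ring_scope.

(** The chirps [exp (- i (a v^2 + d v))] and [exp (- i (c w^2 + e w))] have
modulus one, so the statement is the Plancherel formula for the Dunkl transform
with kernel [E_mu (i beta w, v)], [beta = - 1 / b], and the measure
[|v|^(2 mu + 1) dv]. Write [al = mu + 1].

Up to the factor [Gamma al], the real and imaginary parts of [E_mu (i z)] are
the even function [B_al ((z / 2)^2)] and the odd function
[(z / 2) B_(al + 1) ((z / 2)^2)], where [B_al] ([bessel_series]) is the entire
series [\sum_n (-1)^n y^n / (n! Gamma (n + al))]. Since [B_al' = - B_(al + 1)]
and [B_al = al B_(al + 1) - y B_(al + 2)], the energy [B_al^2 + y B_(al + 1)^2]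
has derivative [- (2 al - 1) B_(al + 1)^2]; as [al >= 1 / 2] it decreases, and
the kernel is bounded ([bessel_energy_le]). Hence the transform of an integrable
function is bounded by a multiple of its L1 norm.

For real functions the sum of the two parts is used as a kernel instead
([hartley]), just as the Hartley transform replaces [cos + i sin] by
[cos + sin]. Integrating the series term by term shows that it maps [exp (- s v^2)]
and [v exp (- s v^2)] to multiples of Gaussians of the same parity
([hartley_bgauss]); comparing explicit inner products, it is isometric on the
linear span of these functions ([hartley_span_isometry]).

The span is dense for the L1 and L2 norms together ([L1L2_approximable]): the
functions [(1 - exp (- n v^2))^N] tend to indicators of [v^2 > r] when [N] grows
suitably with [n], and a monotone class argument gives all bounded Borel functions
of [v^2] times a Gaussian of either parity, hence all functions by splitting into
even and odd parts. If [p_n] tends to [g] in both norms, the transforms converge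
pointwise by the L1 bound and have bounded L2 norm, so Fatou's lemma shows that
the transform contracts the L2 norm ([hartley_contraction]), and the parallelogram
law upgrades this to equality ([hartley_plancherel]).

Finally, for [f = f1 + i f2], the sum of [|D f|^2] at [w] and [- w] only contains
the squares of the even and odd transforms of [f1] and [f2], which are also those
of the real transforms ([complex_plancherel]). *)

(** * The Gamma function *)

Section gamma_function.
Set Implicit Arguments.
Unset Strict Implicit.
Context {R : realType}.
Implicit Types x t s : R.
Local Notation L := (@lebesgue_measure R).

Definition gamma_fun x t : R := t `^ (x - 1) * expR (- t).

Lemma gamma_fun_ge0 x t : 0 <= gamma_fun x t.
Proof. by rewrite mulr_ge0 ?powR_ge0 ?expR_ge0. Qed.

Lemma measurable_gamma_fun x (D : set R) : measurable_fun D (gamma_fun x).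
Proof.
apply: measurable_funTS; apply: measurable_funM.
  exact: measurable_powR.
apply: measurableT_comp => //.
Qed.

(** The inequality [ln u <= u] at [u = t / (2 * x)]. The exponent [t / 2] leaves a
decaying factor once multiplied by [expR (- t)]. *)
Lemma powR_le_expR x t : 0 < x -> 0 < t ->
  t `^ x <= (2 * x) `^ x * expR (t / 2).
Proof.
move=> x0 t0; have x20 : 0 < 2 * x by rewrite mulr_gt0.
rewrite /powR gt_eqF// gt_eqF// -expRD ler_expR.
have -> : ln t = ln (t / (2 * x)) + ln (2 * x).
  by rewrite ln_div// ?subrK.
rewrite mulrDr addrC lerD2l.
have : ln (t / (2 * x)) <= t / (2 * x).
  by apply/ltW/ln_sublinear; rewrite divr_gt0.
move=> /(ler_wpM2l (ltW x0)) /le_trans; apply.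
by rewrite invfM mulrCA (mulrA x) -(mulrA x) (mulrCA x) mulfV ?gt_eqF// mulr1.
Qed.

(** Substitution and integration by parts are carried out on compact intervals away
from 0, where the integrands are smooth; this passes to the half line. *)
Lemma cvg_integral_exhaustion (a b : nat -> R) (f : R -> R) :
  {homo a : m n / (m <= n)%N >-> n <= m} ->
  {homo b : m n / (m <= n)%N >-> m <= n} ->
  (forall n, 0 < a n) -> (forall t, 0 < t -> exists n, a n <= t <= b n) ->
  (forall t, 0 < t -> 0 <= f t) -> measurable_fun setT f ->
  (\int[L]_(t in `[a n, b n]) (f t)%:E)%E @[n --> \oo] -->
  (\int[L]_(t in `]0%R, +oo[) (f t)%:E)%E.
Proof.
move=> a_dec b_inc a_gt0 cover f0 mf.
have pos n t : t \in `[a n, b n] -> 0 < t.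
  by rewrite in_itv/= => /andP[/(lt_le_trans (a_gt0 n))].
have <- : \bigcup_n `[a n, b n]%classic = `]0, +oo[%classic.
  apply/seteqP; split => t /=.
    by move=> [n _] /= /pos; rewrite in_itv/= andbT.
  by rewrite in_itv/= andbT => /cover[n nab]; exists n => //=; rewrite in_itv.
apply: ge0_nondecreasing_set_cvg_integral.
- move=> m n mn; rewrite subsetEset => t /=; rewrite !in_itv/= => /andP[at_ tb].
  by rewrite (le_trans (a_dec _ _ mn) at_) (le_trans tb (b_inc _ _ mn)).
- by move=> n; exact: measurable_itv.
- by move=> n; apply/measurable_EFinP; exact: measurable_funTS.
- by move=> n t /= /pos; rewrite lee_fin; exact: f0.
Qed.

Lemma invSn_le_le_Sn t : 0 < t -> exists n, n.+1%:R^-1 <= t <= n.+1%:R.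
Proof.
move=> t0.
exists (Num.trunc (Num.max t t^-1)).
have := truncnS_gt (Num.max t t^-1); set n := _.+1.
rewrite gt_max => /andP[a b]; apply/andP; split; last exact: ltW.
by rewrite -[t]invrK lef_pV2 ?posrE// ?invr_gt0// ltW.
Qed.

Lemma invSn_homo : {homo (fun n => n.+1%:R^-1 : R) : m n / (m <= n)%N >-> n <= m}.
Proof. by move=> m n mn; rewrite lef_pV2 ?posrE// ler_nat. Qed.

Lemma cvg_integral_invSn_Sn (f : R -> R) : (forall t, 0 < t -> 0 <= f t) ->
  measurable_fun setT f ->
  (\int[L]_(t in `[(n.+1%:R^-1)%R, n.+1%:R%R]) (f t)%:E)%E @[n --> \oo] -->
  (\int[L]_(t in `]0%R, +oo[) (f t)%:E)%E.
Proof.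
apply: cvg_integral_exhaustion.
- exact: invSn_homo.
- by move=> m n mn; rewrite ler_nat.
- by move=> n; rewrite invr_gt0.
- exact: invSn_le_le_Sn.
Qed.

Lemma is_derive_expRN t : is_derive t 1 (fun u : R => - expR (- u)) (expR (- t)).
Proof. by apply: is_derive_eq; rewrite ?scaleN1r ?scaler1 ?mulrN1 ?opprK. Qed.

Lemma gamma_fun_by_parts x a b : 0 < a -> a < b ->
  (\int[L]_(t in `[a, b]) (gamma_fun (x + 1) t)%:E =
   (a `^ x * expR (- a) - b `^ x * expR (- b))%:E +
   x%:E * \int[L]_(t in `[a, b]) (gamma_fun x t)%:E)%E.
Proof.
move=> a0 ab.
have pos t : t \in `[a, b] -> 0 < t by rewrite in_itv/= => /andP[/(lt_le_trans a0)].
have poso t : t \in `]a, b[ -> 0 < t by rewrite in_itv/= => /andP[/(lt_trans a0)].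
have cpow y t : 0 < t -> {for t, continuous (fun u : R => u `^ y)}.
  move=> t0; apply/differentiable_continuous/derivable1_diffP.
  by apply: derivable_powR; rewrite in_itv/= andbT.
have cexp t : {for t, continuous (fun u : R => expR (- u))}.
  apply: continuous_comp; first exact: oppr_continuous.
  exact: continuous_expR.
have dpow : derivable_oo_LRcontinuous (fun t => t `^ x) a b.
  split.
  - by move=> t /poso t0; apply: derivable_powR; rewrite in_itv/= andbT.
  - by apply: cvg_at_right_filter; exact: cpow.
  - by apply: cvg_at_left_filter; apply: cpow; exact: lt_trans ab.
have dexp : derivable_oo_LRcontinuous (fun t : R => - expR (- t)) a b.
  split.
  - by move=> t _; case: (is_derive_expRN t).
  - by apply: cvg_at_right_filter; apply: cvgN; exact: cexp.
  - by apply: cvg_at_left_filter; apply: cvgN; exact: cexp.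
have := @integration_by_parts R (fun t => t `^ x) (fun t => - expR (- t))
  (fun t => x * t `^ (x - 1)) (fun t => expR (- t)) a b ab _ dpow _ _ dexp _.
under [in X in _ -> X]eq_integral do rewrite /gamma_fun addrK.
move=> ->.
- under eq_integral do rewrite mulrN -mulrA -mulNr EFinM.
  rewrite integralZl//; last first.
    apply: continuous_compact_integrable; first exact: segment_compact.
    apply: continuous_in_subspaceT => t; rewrite inE => /pos t0.
    by apply: cvgM; [exact: cpow|exact: cexp].
  rewrite EFinN mulNe oppeK; congr (_ + _)%E.
  by congr EFin; rewrite !mulrN opprK addrC.
- apply: continuous_in_subspaceT => t; rewrite inE => /pos t0.
  by apply: cvgM; [exact: cvg_cst|exact: cpow].
- by move=> t /poso t0; rewrite powR_derive1// in_itv/= andbT.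
- by apply: continuous_subspaceT => t; exact: cexp.
- by move=> t _; rewrite derive1E; case: (is_derive_expRN t).
Qed.

Lemma cvg_expRN_half : expR (- (n.+1%:R / 2) : R) @[n --> \oo] --> 0.
Proof.
apply: (@squeeze_cvgr _ _ _ _ (fun=> 0) (fun n => 2 * @harmonic R n)).
- near=> n; rewrite expR_ge0/= expRN -[2]invrK -invfM lef_pV2 ?posrE ?expR_gt0//.
  by rewrite mulrC; apply: le_trans (expR_ge1Dx _); rewrite invrK lerDr.
- exact: cvg_cst.
- by rewrite -(mulr0 2); apply: cvgM; [exact: cvg_cst|exact: cvg_harmonic].
Unshelve. all: by end_near. Qed.

Lemma cvg_gamma_boundary x : 0 < x ->
  (n.+1%:R^-1 `^ x * expR (- n.+1%:R^-1) - n.+1%:R `^ x * expR (- n.+1%:R) : R)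
    @[n --> \oo] --> 0.
Proof.
move=> x0; rewrite -[X in _ --> X](subr0 0); apply: cvgB.
- have P0 : (n.+1%:R^-1 : R) `^ x @[n --> \oo] --> 0.
    have := @powR_cvg0 R x x0.
    move/cvg_at_rightP; apply; split => //.
    by apply: cvg_harmonic.
  apply: (@squeeze_cvgr _ _ _ _ (fun=> 0) (fun n : nat => (n.+1%:R^-1 : R) `^ x)) => //; last exact: cvg_cst.
  near=> n; rewrite mulr_ge0 ?powR_ge0 ?expR_ge0//=.
  by apply: ler_piMr; rewrite ?powR_ge0// expR_le1 oppr_le0.
- apply: (@squeeze_cvgr _ _ _ _ (fun=> 0)
    (fun n : nat => (2 * x) `^ x * expR (- (n.+1%:R / 2)))).
  + near=> n; rewrite mulr_ge0 ?powR_ge0 ?expR_ge0//=.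
    have := powR_le_expR x0 (ltr0Sn R n).
    move=> /(ler_wpM2r (expR_ge0 (- n.+1%:R))) /le_trans; apply.
    rewrite -mulrA ler_wpM2l ?powR_ge0// -expRD ler_expR.
    lra.
  + exact: cvg_cst.
  + rewrite -(mulr0 ((2 * x) `^ x)); apply: cvgM; first exact: cvg_cst.
    exact: cvg_expRN_half.
Unshelve. all: by end_near. Qed.

(** The integral of [Gamma] before it is turned into a real number. The recurrence
holds for it whether or not it converges, and convergence is then deduced. *)
Definition egamma x : \bar R := (\int[L]_(t in `]0%R, +oo[) (gamma_fun x t)%:E)%E.

Lemma egamma_ge0 x : (0 <= egamma x)%E.
Proof. by apply: integral_ge0 => t _; rewrite lee_fin gamma_fun_ge0. Qed.

Lemma egammaS x : 0 < x -> egamma (x + 1) = (x%:E * egamma x)%E.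
Proof.
move=> x0.
have h1 := cvg_integral_invSn_Sn (fun t _ => gamma_fun_ge0 (x + 1) t) (@measurable_gamma_fun (x + 1) setT).
have h0 := cvg_integral_invSn_Sn (fun t _ => gamma_fun_ge0 x t) (@measurable_gamma_fun x setT).
have hb : (n.+1%:R^-1 `^ x * expR (- n.+1%:R^-1) - n.+1%:R `^ x * expR (- n.+1%:R) : R)%:E
    @[n --> \oo] --> 0%:E.
  by apply: cvg_EFin; [near=> n|exact: cvg_gamma_boundary].
have h2 : ((n.+1%:R^-1 `^ x * expR (- n.+1%:R^-1)
      - n.+1%:R `^ x * expR (- n.+1%:R))%:E +
    x%:E * \int[L]_(t in `[(n.+1%:R^-1)%R, n.+1%:R%R]) (gamma_fun x t)%:E)%E @[n --> \oo] -->
    (0%:E + x%:E * egamma x)%E by apply: cvgeD => //; exact: cvgeZl h0.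
rewrite add0e in h2.
suff h3 : (\int[L]_(t in `[(n.+1%:R^-1)%R, n.+1%:R%R]) (gamma_fun (x + 1) t)%:E)%E @[n --> \oo] -->
    (x%:E * egamma x)%E by exact: (cvg_unique _ h1 h3).
move: h2; apply: cvg_trans; apply: near_eq_cvg.
near=> n; apply/esym/gamma_fun_by_parts; first by rewrite invr_gt0.
have n1 : 1 < n.+1%:R :> R by rewrite ltr1n ltnS; near: n; exists 1%N.
by apply: (lt_trans _ n1); rewrite invf_lt1 ?ltr0Sn.
Unshelve. all: by end_near. Qed.

Lemma integrable_gamma_funS x : 0 < x ->
  L.-integrable `]0%R, +oo[ (EFin \o gamma_fun (x + 1)).
Proof.
move=> x0.
have h := integrable_exponential_pdf (@ltr0Sn R 1 : 0 < 2) .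
have h2 : (0:R) < 2^-1 by rewrite invr_gt0.
have {}h := integrableZl measurableT (2 * (2 * x) `^ x) (integrable_exponential_pdf h2).
apply: le_integrable (integrableS measurableT _ _ h) => //.
  by apply/measurable_EFinP; exact: measurable_gamma_fun.
move=> t /=; rewrite in_itv/= andbT => t0.
rewrite lee_fin ger0_norm ?gamma_fun_ge0// ger0_norm; last first.
  by rewrite mulr_ge0 ?exponential_pdf_ge0 ?mulr_ge0 ?powR_ge0.
rewrite (exponential_pdfE _ (ltW t0)) /gamma_fun addrK.
have := powR_le_expR x0 t0.
move=> /(ler_wpM2r (expR_ge0 (- t))) /le_trans; apply.
rewrite -mulrA -expRD (_ : t / 2 + - t = - 2^-1 * t); last by field.
by rewrite le_eqVlt; apply/orP; left; apply/eqP; field.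
Qed.

(** There is no singularity at 0 for the parameter [x + 1], and the recurrence brings
convergence down to [x]. *)
Lemma integrable_gamma_fun x : 0 < x ->
  L.-integrable `]0%R, +oo[ (EFin \o gamma_fun x).
Proof.
move=> x0; apply/integrableP; split.
  by apply/measurable_EFinP; exact: measurable_gamma_fun.
under eq_integral do rewrite /= ger0_norm ?gamma_fun_ge0//.
rewrite -/(egamma x).
have : egamma (x + 1) \is a fin_num.
  by apply: integrable_fin_num => //; exact: integrable_gamma_funS.
rewrite egammaS//.
have := egamma_ge0 x; case: (egamma x) => [r| |]//= _.
  by move=> _; exact: ltry.
by rewrite gt0_muley ?lte_fin.
Qed.

Lemma egammaE x : 0 < x -> egamma x = (Gamma x)%:E.
Proof.
move=> x0; rewrite /Gamma /Rintegral fineK//.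
by apply: integrable_fin_num => //; exact: integrable_gamma_fun.
Qed.

Lemma GammaS x : 0 < x -> Gamma (x + 1) = x * Gamma x.
Proof.
move=> x0; have := egammaS x0.
by rewrite !egammaE ?addr_gt0// -EFinM => -[].
Qed.

Lemma Gamma_ge0 x : 0 <= Gamma x.
Proof. by apply: Rintegral_ge0 => t _; exact: gamma_fun_ge0. Qed.

(** For the parameter [x + 1] the integrand is at least [expR (- 2)] between 1 and 2. *)
Lemma Gamma_gt0 x : 0 < x -> 0 < Gamma x.
Proof.
move=> x0.
suff : 0 < Gamma (x + 1) by rewrite GammaS// pmulr_rgt0.
rewrite -lte_fin -egammaE ?addr_gt0//.
apply: (@lt_le_trans _ _ (\int[L]_(t in `[1%R, 2%R]) (expR (- 2))%:E)%E).
  rewrite (_ : (fun _ => _) = cst (expR (- 2))%:E)// integral_cst//=.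
  rewrite lebesgue_measure_itv/= lte_fin ltr1n.
  by rewrite -EFinB -EFinM lte_fin mulr_gt0 ?expR_gt0 ?subr_gt0 ?ltr1n.
apply: (@le_trans _ _ (\int[L]_(t in `[1%R, 2%R]) (gamma_fun (x + 1) t)%:E)%E).
  apply: ge0_le_integral => //.
  - by apply/measurable_EFinP; exact: measurable_gamma_fun.
  - move=> t; rewrite /= in_itv/= => /andP[t1 t2]; rewrite lee_fin /gamma_fun addrK.
    rewrite -[leLHS]mul1r ler_pM ?expR_ge0//; last by rewrite ler_expR lerN2.
    by rewrite -(powRr0 t) ler_powR// ltW.
apply: ge0_subset_integral => //.
- by apply/measurable_EFinP; exact: measurable_gamma_fun.
- by move=> t _; rewrite lee_fin gamma_fun_ge0.
- move=> t /=; rewrite !in_itv/= => /andP[t1 _]; rewrite andbT.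
  exact: lt_le_trans t1.
Qed.

End gamma_function.

Local Opaque Gamma.

(** * Gaussian moments *)

Section gaussian_moments.
Context {R : realType}.
Implicit Types x t s v : R.
Set Implicit Arguments.
Unset Strict Implicit.
Local Notation L := (@lebesgue_measure R).

Lemma ge0_integral_reflect (f : R -> \bar R) : measurable_fun setT f ->
  (forall v, 0 <= f v)%E -> (\int[L]_v f (- v)%R = \int[L]_v f v)%E.
Proof.
move=> mf f0.
transitivity (\int[L]_(v in (-%R : _ -> measurableTypeR R) @^-1` setT) f (- v)%R)%E.
  by rewrite preimage_setT.
rewrite -ge0_integral_pushforward//=.
by apply: eq_measure_integral => //= A mA AS; exact: lebesgue_measureN.
Qed.

Lemma ge0_integral_even (f : R -> R) : measurable_fun setT f ->
  (forall v, 0 <= f v) -> (forall v, f (- v) = f v) ->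
  (\int[L]_v (f v)%:E = 2%:E * \int[L]_(v in `]0%R, +oo[) (f v)%:E)%E.
Proof.
move=> mf f0 evenf.
have mEf : measurable_fun setT (EFin \o f) by apply/measurable_EFinP.
rewrite -(setUv `[(0:R), +oo[%classic) ge0_integral_setU//=; last 4 first.
- exact: measurableC.
- by rewrite setUv.
- by move=> v _; rewrite lee_fin.
- exact/disj_setPCl.
rewrite setCitvr integral_itv_bndo_bndc; last exact: measurable_funTS.
under [X in (_ + X)%E]eq_integral do rewrite -evenf.
rewrite -(@ge0_integration_by_substitution0 _ (EFin \o f))//=.
rewrite mule_natl mule2n integral_itv_obnd_cbnd//.
exact: measurable_funTS.
Qed.

(** With this exponent of [|v|], the total mass is [s `^ (- x) * Gamma x]. *)
Definition wgauss x s v := `|v| `^ (2 * x - 1) * expR (- s * v ^+ 2).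

Lemma measurable_wgauss x s : measurable_fun setT (wgauss x s).
Proof.
apply: measurable_funM.
  apply: (measurableT_comp (measurable_powR _)).
  exact: normr_measurable.
apply: measurableT_comp => //; apply: measurable_funM => //.
Qed.

Lemma wgauss_ge0 x s v : 0 <= wgauss x s v.
Proof. by rewrite mulr_ge0 ?powR_ge0 ?expR_ge0. Qed.

Lemma wgauss_subst x s v : 0 < x -> 0 < s -> 0 < v ->
  gamma_fun x (s * v ^+ 2) * (2 * s * v) = 2 * s `^ x * wgauss x s v.
Proof.
move=> x0 s0 v0; rewrite /gamma_fun /wgauss gtr0_norm//.
have -> : - (s * v ^+ 2) = - s * v ^+ 2 by rewrite mulNr.
rewrite powRM ?sqr_ge0// ?ltW//.
have -> : s `^ x = s * s `^ (x - 1) by rewrite mulr_powRB1 ?ltW.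
have -> : v `^ (2 * x - 1) = v * (v ^+ 2) `^ (x - 1).
  rewrite -[in X in X `^ (x - 1)]powR_mulrn ?ltW// -powRrM.
  rewrite -{2}[v]powRr1 ?ltW// -powRD; last by rewrite (gt_eqF v0) implybT.
  by congr (_ `^ _); ring.
ring.
Qed.

(** The substitution [t = s * v ^+ 2] turns the integral over the half line into
that of [Gamma]. *)
Lemma integral_wgauss x s : 0 < x -> 0 < s ->
  (\int[L]_v (wgauss x s v)%:E = (s `^ (- x) * Gamma x)%:E)%E.
Proof.
move=> x0 s0.
rewrite ge0_integral_even; last 3 first.
- exact: measurable_wgauss.
- exact: wgauss_ge0.
- by move=> v; rewrite /wgauss normrN sqrrN.
have hg : (\int[L]_(t in `[(s * n.+1%:R^-1 ^+ 2)%R, (s * n.+1%:R ^+ 2)%R]) (gamma_fun x t)%:E)%E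
    @[n --> \oo] --> egamma x.
  apply: cvg_integral_exhaustion.
  - move=> m n mn; rewrite ler_pM2l// lerXn2r// ?nnegrE ?invr_ge0//.
    exact: invSn_homo.
  - by move=> m n mn; rewrite ler_pM2l// lerXn2r// ?nnegrE// ler_nat.
  - by move=> n; rewrite mulr_gt0// exprn_gt0// invr_gt0.
  - move=> t t0.
    have t0' : 0 < Num.sqrt (t / s) by rewrite sqrtr_gt0 divr_gt0.
    have [n /andP[h1 h2]] := invSn_le_le_Sn t0'; exists n.
    have -> : t = s * Num.sqrt (t / s) ^+ 2.
      by rewrite sqr_sqrtr ?divr_ge0 ?ltW// mulrC divfK// gt_eqF.
    by rewrite !ler_pM2l// !lerXn2r// ?nnegrE ?invr_ge0// ltW.
  - by move=> t _; exact: gamma_fun_ge0.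
  - exact: measurable_gamma_fun.
have hw : (\int[L]_(v in `[(n.+1%:R^-1)%R, n.+1%:R%R]) (2 * s `^ x * wgauss x s v)%:E)%E
    @[n --> \oo] --> (\int[L]_(v in `]0%R, +oo[) (2 * s `^ x * wgauss x s v)%:E)%E.
  apply: cvg_integral_invSn_Sn.
    by move=> t _; rewrite mulr_ge0 ?wgauss_ge0// mulr_ge0 ?powR_ge0.
  by apply: measurable_funM => //; exact: measurable_wgauss.
pose F u : R := s * u ^+ 2.
have dF (v : R) : is_derive v 1 F (2 * s * v).
  rewrite (_ : F = s \*: (id ^+ 2)); last by apply/funext.
  by apply: is_derive_eq; rewrite /= expr1 scaler1; rewrite /GRing.scale/=; ring.
have dFE : (derive1 F) = (fun v => 2 * s * v).
  by apply/funext => v; rewrite derive1E; case: (dF v).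
have cF : continuous F.
  by move=> v; apply/differentiable_continuous/derivable1_diffP; case: (dF v).
have cdF : continuous (derive1 F).
  by rewrite dFE => v; apply: cvgM; [exact: cvg_cst|exact: cvg_id].
have : (\int[L]_(v in `]0%R, +oo[) (2 * s `^ x * wgauss x s v)%:E)%E = egamma x.
  suff hg' : (\int[L]_(v in `[(n.+1%:R^-1)%R, n.+1%:R%R]) (2 * s `^ x * wgauss x s v)%:E)%E
      @[n --> \oo] --> egamma x by exact: (cvg_unique _ hw hg').
  move: hg; apply: cvg_trans; apply: near_eq_cvg; near=> n.
  set a := n.+1%:R^-1; set b := n.+1%:R.
  have a0 : 0 < a by rewrite invr_gt0.
  have ab : a <= b.
    by rewrite (@le_trans _ _ 1)// ?ler1n// invf_le1// ler1n.
  have pos v : v \in `[a, b] -> 0 < v.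
    by rewrite in_itv/= => /andP[/(lt_le_trans a0)].
  rewrite -/(F a) -/(F b) (@integration_by_substitution_increasing _ F (gamma_fun x) a b ab).
  - apply: eq_integral => v; rewrite inE/= => /pos v0.
    by rewrite !fctE -wgauss_subst// dFE.
  - move=> u v /pos u0 /pos v0 uv; rewrite /F ltr_pM2l//.
    by apply: ltrXn2r => //; exact: ltW.
  - by move=> v _; exact: cdF.
  - by apply/cvg_ex; exists ((derive1 F) a); apply: cvg_at_right_filter; exact: cdF.
  - by apply/cvg_ex; exists ((derive1 F) b); apply: cvg_at_left_filter; exact: cdF.
  - split.
    + by move=> v _; case: (dF v).
    + by apply: cvg_at_right_filter; exact: cF.
    + by apply: cvg_at_left_filter; exact: cF.
  - apply: continuous_in_subspaceT => t; rewrite inE/= in_itv/= => /andP[Fat _].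
    have t0 : 0 < t by apply: lt_le_trans Fat; rewrite mulr_gt0// exprn_gt0.
    have cpow : {for t, continuous (fun u : R => u `^ (x - 1))}.
      apply/differentiable_continuous/derivable1_diffP.
      by apply: derivable_powR; rewrite in_itv/= andbT.
    have cexp : {for t, continuous (fun u : R => expR (- u))}.
      apply: continuous_comp; first exact: oppr_continuous.
      exact: continuous_expR.
    by apply: cvgM; [exact: cpow|exact: cexp].
rewrite egammaE//.
under eq_integral do rewrite EFinM.
rewrite ge0_integralZl//=; last 3 first.
- by apply/measurable_EFinP/measurable_funTS; exact: measurable_wgauss.
- by move=> v _; rewrite lee_fin wgauss_ge0.
- by rewrite lee_fin mulr_ge0 ?powR_ge0.
have : (0 <= \int[L]_(v in `]0%R, +oo[) (wgauss x s v)%:E)%E.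
  by apply: integral_ge0 => v _; rewrite lee_fin wgauss_ge0.
have sx : 0 < s `^ x by exact: powR_gt0.
case: (\int[L]_(v in _) _)%E => [r| |]//=.
  rewrite lee_fin -!EFinM => r0 [<-]; congr EFin.
  by rewrite powRN; field; rewrite gt_eqF.
by rewrite gt0_muley// lte_fin mulr_gt0.
Unshelve. all: by end_near. Qed.

End gaussian_moments.

(** * The Bessel series *)

Section bessel_series.
Context {R : realType}.
Implicit Types a x y : R.
Set Implicit Arguments.
Unset Strict Implicit.

Definition bessel_coef a n : R := (-1) ^+ n / (n`!%:R * Gamma (n%:R + a)).

(** In this normalization [j_mu z = Gamma (mu + 1) * B (mu + 1) ((z / 2) ^+ 2)]; in
the squared variable the family is stable under differentiation. *)
Definition bessel_series a y : R := limn (pseries (bessel_coef a) y).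

Lemma addn_gt0 a n : 0 < a -> 0 < n%:R + a.
Proof. by move=> a0; rewrite ltr_wpDl. Qed.

Lemma GammaSn a n : 0 < a -> Gamma (n.+1%:R + a) = (n%:R + a) * Gamma (n%:R + a).
Proof. by move=> a0; rewrite -(GammaS (addn_gt0 n a0)) -natr1 addrAC. Qed.

(** All factors of [Gamma (n%:R + a) / Gamma a] are at least 1, except possibly the
first one, which is [a]. *)
Lemma Gamma_lower_bound a n : 1 / 2 <= a -> Gamma a / 2 <= Gamma (n%:R + a).
Proof.
move=> ha; have a0 : 0 < a by lra.
have g0 := Gamma_gt0 a0.
case: n => [|n]; first by rewrite add0r; lra.
elim: n => [|n IH]; first by rewrite GammaSn// !add0r; nra.
rewrite GammaSn//; apply: (le_trans IH).
apply: ler_peMl; first exact: Gamma_ge0.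
by rewrite -[leLHS]addr0 lerD ?ler1n ?ltW.
Qed.

Lemma bessel_coef_le a n : 1 / 2 <= a ->
  `|bessel_coef a n| <= 2 / Gamma a * (n`!%:R)^-1.
Proof.
move=> ha; have a0 : 0 < a by lra.
rewrite normrM normrX normrN normr1 expr1n mul1r normfV ger0_norm; last first.
  by rewrite mulr_ge0// Gamma_ge0.
rewrite invfM mulrC ler_pM2r ?invr_gt0 ?ltr0n ?fact_gt0//.
rewrite -[2 / _]invrK invfM invrK lef_pV2 ?posrE ?Gamma_gt0 ?addn_gt0//.
  by rewrite mulrC; exact: Gamma_lower_bound.
by rewrite mulr_gt0 ?Gamma_gt0 ?invr_gt0.
Qed.

Lemma is_cvg_bessel_norm a y : 1 / 2 <= a ->
  cvgn [normed series (fun n => bessel_coef a n * y ^+ n)].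
Proof.
move=> ha; have a0 : 0 < a by lra.
apply: (@series_le_cvg _ _ ((2 / Gamma a) *: exp_coeff `|y|)).
- by move=> n; rewrite normr_ge0.
- by move=> n; apply: mulr_ge0; rewrite divr_ge0 ?Gamma_ge0.
- move=> n; rewrite /= normrM normrX /exp_coeff/= /GRing.scale/=.
  rewrite [X in _ <= _ * X]mulrC mulrA ler_wpM2r//.
  exact: bessel_coef_le.
- by apply: is_cvg_seriesZ; exact: is_cvg_series_exp_coeff.
Qed.

Lemma is_cvg_bessel a y : 1 / 2 <= a -> cvgn (pseries (bessel_coef a) y).
Proof. by move=> ha; apply: normed_cvg; exact: is_cvg_bessel_norm. Qed.

Lemma pseries_diffs_bessel a :
  pseries_diffs (bessel_coef a) = - bessel_coef (a + 1).
Proof.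
apply/funext => n; rewrite /pseries_diffs /bessel_coef fctE.
rewrite exprS factS natrM -[in n.+1%:R + a]natr1 -!addrA (addrC 1 a).
have f0 : n`!%:R != 0 :> R by rewrite pnatr_eq0 -lt0n fact_gt0.
rewrite !invfM; set g := (Gamma _)^-1; set m := n.+1%:R.
have m0 : m != 0 by rewrite pnatr_eq0.
by clearbody m; field; rewrite f0 m0.
Qed.

Lemma pseries_opp (c : R^nat) y : pseries (- c) y = - pseries c y.
Proof.
rewrite /pseries -seriesN; congr series.
by apply/funext => n; exact: mulNr.
Qed.

Lemma is_derive_bessel a y : 1 / 2 <= a ->
  is_derive y 1 (bessel_series a) (- bessel_series (a + 1) y).
Proof.
move=> ha; have ha1 : 1 / 2 <= a + 1 by lra.
have ha2 : 1 / 2 <= a + 1 + 1 by lra.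
have := @pseries_snd_diffs R (bessel_coef a) (`|y| + 1) y.
rewrite pseries_diffs_bessel pseries_diffsN pseries_diffs_bessel opprK.
have limNE : limn (- pseries (bessel_coef (a + 1)) y) = - bessel_series (a + 1) y.
  by apply: limN; exact: is_cvg_bessel.
rewrite !pseries_opp limNE; apply.
- exact: is_cvg_bessel.
- by rewrite is_cvgNE; exact: is_cvg_bessel.
- exact: is_cvg_bessel.
- by rewrite [ltRHS]ger0_norm ?addr_ge0// ltrDl.
Qed.

Lemma continuous_bessel a : 1 / 2 <= a -> continuous (bessel_series a).
Proof.
move=> ha y; apply/differentiable_continuous/derivable1_diffP.
by case: (is_derive_bessel y ha).
Qed.

Lemma bessel_coef_rec a n : 0 < a ->
  bessel_coef a n = (n%:R + a) * bessel_coef (a + 1) n.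
Proof.
move=> a0; rewrite /bessel_coef (_ : n%:R + (a + 1) = n.+1%:R + a); last first.
  by rewrite -natr1; ring.
have na0 := addn_gt0 n a0; have Gna0 := Gamma_gt0 na0.
have f0 : n`!%:R != 0 :> R by rewrite pnatr_eq0 -lt0n fact_gt0.
by rewrite GammaSn//; field; rewrite f0 !gt_eqF.
Qed.

(** This is Bessel's differential equation, written for the squared variable. *)
Lemma bessel_series_rec a y : 1 / 2 <= a ->
  bessel_series a y = a * bessel_series (a + 1) y - y * bessel_series (a + 1 + 1) y.
Proof.
move=> ha; have a0 : 0 < a by lra.
have ha1 : 1 / 2 <= a + 1 by lra.
have ha2 : 1 / 2 <= a + 1 + 1 by lra.
have c1 := @is_cvg_bessel _ y ha1.
have := @pseries_diffs_equiv R (bessel_coef (a + 1)) y.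
have limNE : limn (- pseries (bessel_coef (a + 1 + 1)) y) =
    - bessel_series (a + 1 + 1) y by apply: limN; exact: is_cvg_bessel.
rewrite pseries_diffs_bessel pseries_opp is_cvgNE limNE.
move=> /(_ (@is_cvg_bessel _ y ha2)).
set s := (fun i : nat => _) => cs.
have -> : bessel_series a y =
    limn (a *: series (fun n => bessel_coef (a + 1) n * y ^+ n) + y *: series s).
  congr (limn _); rewrite /pseries -!seriesZ -seriesD; congr series.
  apply/funext => n; rewrite !fctE /s /GRing.scale/=.
  have -> : y * (n%:R * bessel_coef (a + 1) n * y ^+ n.-1) =
      n%:R * bessel_coef (a + 1) n * y ^+ n.
    case: n => [|n] /=; first by rewrite !mul0r mulr0.
    by rewrite exprS; ring.
  by rewrite bessel_coef_rec//; ring.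
apply/cvg_lim => //; apply: cvgD.
  by apply: cvgZl_tmp.
by rewrite -mulrN; apply: cvgZl_tmp.
Qed.

Lemma bessel_series0 a : bessel_series a 0 = (Gamma a)^-1.
Proof.
apply/cvg_lim => //; rewrite /pseries -cvg_shiftS /=.
apply: cvg_near_cst; near=> n; rewrite /series/= big_nat_recl// big1 => [|i _].
  by rewrite addr0 /bessel_coef !expr0 fact0 mulr1 !mul1r add0r.
by rewrite expr0n mulr0.
Unshelve. all: by end_near. Qed.

(** The energy [f ^+ 2 + x * g ^+ 2] has derivative [- (2 * a - 1) * g ^+ 2]. For the
Bessel series it is, up to a constant, the squared modulus of the Dunkl kernel. *)
Lemma energy_le (f g dg : R -> R) a y : 1 / 2 <= a -> 0 <= y ->
  (forall x, is_derive x 1 f (- g x)) -> (forall x, is_derive x 1 g (dg x)) ->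
  (forall x, f x = a * g x + x * dg x) ->
  f y ^+ 2 + y * g y ^+ 2 <= f 0 ^+ 2.
Proof.
move=> ha y0 df dg' rec.
pose E := fun y => f y * f y + y * (g y * g y).
have dE (x : R) : is_derive x 1 E (- (2 * a - 1) * g x ^+ 2).
  have d := is_deriveD (is_deriveM (df x) (df x))
    (is_deriveM (is_derive_id x (1 : R)) (is_deriveM (dg' x) (dg' x))).
  apply: (is_derive_eq d); rewrite /GRing.scale/= rec.
  have -> : (g * g) x = g x * g x by [].
  ring.
have [|c _] := @MVT_segment R E (fun x => - (2 * a - 1) * g x ^+ 2) 0 y y0 (fun x _ => dE x).
  apply: continuous_subspaceT => x.
  by apply/differentiable_continuous/derivable1_diffP; case: (dE x).
rewrite subr0 => Ey.
have Ele : E y <= E 0.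
  rewrite -subr_le0 Ey mulNr mulNr oppr_le0 mulr_ge0// mulr_ge0 ?sqr_ge0//; lra.
by move: Ele; rewrite /E mul0r addr0 -!expr2.
Qed.

Lemma bessel_energy_le a y : 1 / 2 <= a -> 0 <= y ->
  bessel_series a y ^+ 2 + y * bessel_series (a + 1) y ^+ 2 <= (Gamma a)^-1 ^+ 2.
Proof.
move=> ha y0.
have ha1 : 1 / 2 <= a + 1 by lra.
rewrite -bessel_series0.
apply: (@energy_le (bessel_series a) (bessel_series (a + 1))
  (fun x => - bessel_series (a + 1 + 1) x) a y ha y0) => x.
- exact: is_derive_bessel.
- exact: is_derive_bessel.
- by rewrite mulrN; exact: bessel_series_rec.
Qed.

Lemma bessel_series_bound a y : 1 / 2 <= a -> 0 <= y ->
  `|Gamma a * bessel_series a y| <= 1 /\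
  `|Gamma a * (Num.sqrt y * bessel_series (a + 1) y)| <= 1.
Proof.
move=> ha y0; have G0 : 0 < Gamma a by apply: Gamma_gt0; lra.
have := bessel_energy_le ha y0.
rewrite exprVn -[X in _ <= X]mul1r ler_pdivlMr ?exprn_gt0//.
rewrite mulrDl => h.
have b1 : 0 <= bessel_series a y ^+ 2 * Gamma a ^+ 2.
  by rewrite mulr_ge0 ?sqr_ge0.
have b2 : 0 <= y * bessel_series (a + 1) y ^+ 2 * Gamma a ^+ 2.
  by rewrite mulr_ge0 ?sqr_ge0// mulr_ge0 ?sqr_ge0.
split; rewrite -(@ler_pXn2r _ 2)// ?nnegrE// expr1n real_normK ?num_real//.
  by rewrite exprMn mulrC (le_trans _ h)// lerDl.
rewrite exprMn exprMn sqr_sqrtr// mulrC (le_trans _ h)// lerDr//.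
Qed.

End bessel_series.

Local Opaque bessel_series.

(** * Integration of the Bessel series against a Gaussian *)

Section real_integration.
Context {R : realType}.
Implicit Types (f g : R -> R).
Set Implicit Arguments.
Unset Strict Implicit.
Local Notation L := (@lebesgue_measure R).

Lemma integrable_dominated f g : measurable_fun setT f ->
  (forall v, `|f v| <= g v) -> L.-integrable setT (EFin \o g) ->
  L.-integrable setT (EFin \o f).
Proof.
move=> mf fg; apply: le_integrable => //; first exact/measurable_EFinP.
by move=> v _; rewrite /= lee_fin (le_trans (fg v))// ler_norm.
Qed.

Lemma ge0_integrable f r : measurable_fun setT f -> (forall v, 0 <= f v) ->
  (\int[L]_v (f v)%:E = r%:E)%E -> L.-integrable setT (EFin \o f).
Proof.
move=> mf f0 fr; apply/integrableP; split; first exact/measurable_EFinP.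
by under eq_integral do rewrite /= ger0_norm//; rewrite fr ltry.
Qed.

Lemma integral_RintegralE f : L.-integrable setT (EFin \o f) ->
  (\int[L]_v (f v)%:E = (\int[L]_v f v)%:E)%E.
Proof. by move=> fi; rewrite /Rintegral fineK//; exact: integrable_fin_num. Qed.

Lemma integrable_EFinZ r f : L.-integrable setT (EFin \o f) ->
  L.-integrable setT (EFin \o (fun v => r * f v)).
Proof.
by move=> /(integrableZl measurableT r); apply: eq_integrable.
Qed.

Lemma integrable_EFinD f g : L.-integrable setT (EFin \o f) ->
  L.-integrable setT (EFin \o g) -> L.-integrable setT (EFin \o (fun v => f v + g v)).
Proof.
by move=> fi /(integrableD measurableT fi); apply: eq_integrable.
Qed.

(** Truncations away from the origin need not converge at 0. *)
Lemma dominated_convergence_punctured (f_ : (R -> R)^nat) f g :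
  (forall n, measurable_fun setT (f_ n)) -> measurable_fun setT f ->
  (forall v, v != 0 -> f_ n v @[n --> \oo] --> f v) ->
  L.-integrable setT (EFin \o g) -> (forall n v, `|f_ n v| <= g v) ->
  L.-integrable setT (EFin \o f) /\
  (\int[L]_v f_ n v @[n --> \oo] --> \int[L]_v f v).
Proof.
move=> mf_ mf f_f ig f_g.
have [||||| fi _ cf] := @dominated_convergence _ _ R L setT measurableT
  (fun n v => (f_ n v)%:E) (EFin \o f) (EFin \o g).
- by move=> n; apply/measurable_EFinP; exact: mf_.
- exact/measurable_EFinP.
- exists [set 0]; split; [exact: measurable_set1|exact: lebesgue_measure_set1|].
  move=> v /= h; apply: contrapT => v0; apply: h => _.
  by apply: cvg_EFin; [apply: nearW => n|apply: f_f; exact/eqP].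
- exact: ig.
- by apply: aeW => v n _; rewrite /= lee_fin.
split; first exact: fi.
by move: cf; rewrite /= integral_RintegralE// => /fine_cvgP[_].
Qed.

End real_integration.

Section termwise.
Context {R : realType}.
Implicit Types (a k s v : R).
Set Implicit Arguments.
Unset Strict Implicit.
Local Notation L := (@lebesgue_measure R).

Lemma integrable_wgauss a s : 0 < a -> 0 < s ->
  L.-integrable setT (EFin \o wgauss a s).
Proof.
move=> a0 s0; apply: (ge0_integrable (r := s `^ (- a) * Gamma a)).
- exact: measurable_wgauss.
- exact: wgauss_ge0.
- exact: integral_wgauss.
Qed.

Lemma Rintegral_wgauss a s : 0 < a -> 0 < s ->
  \int[L]_v wgauss a s v = s `^ (- a) * Gamma a.
Proof. by move=> a0 s0; rewrite /Rintegral integral_wgauss. Qed.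

Lemma wgauss_exprM a s v n : 1 / 2 <= a ->
  (v ^+ 2) ^+ n * wgauss a s v = wgauss (n%:R + a) s v.
Proof.
move=> ha; rewrite /wgauss mulrA; congr (_ * _).
case: n => [|n]; first by rewrite expr0 mul1r add0r.
rewrite -(real_normK (num_real v)) -exprM -powR_mulrn// -powRD.
  by congr (_ `^ _); rewrite natrM; ring.
apply/implyP => /eqP h; exfalso.
have : 0 < (2 * n.+1)%:R :> R by rewrite ltr0n.
by move: h; lra.
Qed.

Definition bessel_gauss_term a k s n v : R :=
  bessel_coef a n * k ^+ n * wgauss (n%:R + a) s v.

Lemma bessel_gauss_termE a k s n v : 1 / 2 <= a ->
  bessel_coef a n * (k * v ^+ 2) ^+ n * wgauss a s v = bessel_gauss_term a k s n v.
Proof. by move=> ha; rewrite /bessel_gauss_term -wgauss_exprM// exprMn; ring. Qed.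

(** The moment of the Gaussian cancels the Gamma factor of the Bessel coefficient,
which leaves a term of an exponential series. *)
Lemma bessel_gauss_coef a k s n : 1 / 2 <= a -> 0 < s ->
  bessel_coef a n * k ^+ n * (s `^ (- (n%:R + a)) * Gamma (n%:R + a)) =
  s `^ (- a) * exp_coeff (- (k / s)) n.
Proof.
move=> ha s0; have a0 : 0 < a by lra.
have na0 := addn_gt0 n a0.
rewrite opprD powRD ?(gt_eqF s0) ?implybT// (powRN s n%:R) powR_mulrn ?ltW//.
have -> : exp_coeff (- (k / s)) n =
    (-1) ^+ n * k ^+ n / (s ^+ n * n`!%:R).
  by rewrite /exp_coeff/= -(mulN1r (k / s)) exprMn exprMn exprVn invfM !mulrA.
have f0 : n`!%:R != 0 :> R by rewrite pnatr_eq0 -lt0n fact_gt0.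
have G0 := Gamma_gt0 na0; have sn0 := exprn_gt0 n s0.
by rewrite /bessel_coef; field; rewrite f0 !gt_eqF.
Qed.

Lemma measurable_bessel_gauss_term a k s n :
  measurable_fun setT (bessel_gauss_term a k s n).
Proof. by apply: measurable_funM => //; exact: measurable_wgauss. Qed.

Lemma integral_bessel_gauss_term_norm a k s n : 1 / 2 <= a -> 0 < s ->
  (\int[L]_v (`|bessel_gauss_term a k s n v|)%:E =
   (s `^ (- a) * exp_coeff (`|k| / s) n)%:E)%E.
Proof.
move=> ha s0; have a0 : 0 < a by lra.
have na0 := addn_gt0 n a0.
under eq_integral => v _.
  rewrite /bessel_gauss_term normrM [X in _ * X]ger0_norm ?wgauss_ge0// EFinM.
  over.
rewrite ge0_integralZl//=; last 2 first.
- by apply/measurable_EFinP; exact: measurable_wgauss.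
- by move=> v _; rewrite lee_fin wgauss_ge0.
rewrite integral_wgauss// -EFinM; congr EFin.
have := bessel_gauss_coef (- `|k|) n ha s0; rewrite mulNr opprK => <-.
congr (_ * _); rewrite normrM; rewrite exprNn normrX mulrCA mulrA; congr (_ * _).
rewrite /bessel_coef normrM normrX normrN normr1 expr1n mul1r normfV ger0_norm.
  by rewrite mulrA -exprMn mulrNN mulr1 expr1n mul1r.
by rewrite mulr_ge0// Gamma_ge0.
Qed.

(** The dominating function is the sum of the absolute values of all the terms; integrated
term by term, it gives a convergent exponential series. *)
Lemma bessel_gauss_dominated a k s : 1 / 2 <= a -> 0 < s ->
  exists2 G : R -> \bar R, L.-integrable setT G &
   forall n v, (`|(\sum_(0 <= i < n) bessel_gauss_term a k s i v)%:E| <= G v)%E.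
Proof.
move=> ha s0; have a0 : 0 < a by lra.
exists (fun v => \sum_(n <oo) (`|bessel_gauss_term a k s n v|)%:E)%E.
  apply/integrableP; split.
    apply: ge0_emeasurable_sum => [n v _ _|n _]; first by rewrite lee_fin.
    by apply/measurable_EFinP; apply: measurableT_comp => //; exact: measurable_bessel_gauss_term.
  under eq_integral => v _.
    rewrite gee0_abs; last by apply: nneseries_ge0 => n _ _; rewrite lee_fin.
    over.
  rewrite integral_nneseries//=; last first.
    move=> n; apply/measurable_EFinP; apply: measurableT_comp => //.
    exact: measurable_bessel_gauss_term.
  under eq_eseriesr do rewrite integral_bessel_gauss_term_norm//.
  pose u := s `^ (- a) *: exp_coeff (`|k| / s).
  have cu : cvgn (series u) by apply: is_cvg_seriesZ; exact: is_cvg_series_exp_coeff.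
  rewrite [ltLHS](_ : _ = (limn (series u))%:E) ?ltry//.
  rewrite -EFin_lim//; congr (limn _); apply/funext => n.
  by rewrite /= sumEFin.
move=> n v; rewrite abse_EFin.
apply: (@le_trans _ _ (\sum_(0 <= i < n) (`|bessel_gauss_term a k s i v|)%:E)%E).
  by rewrite sumEFin lee_fin ler_norm_sum.
by apply: nneseries_lim_ge => i _ _; rewrite lee_fin.
Qed.

(** Gaussians are mapped to Gaussians by the Hankel transform. *)
Lemma integral_bessel_gauss a k s : 1 / 2 <= a -> 0 < s ->
  L.-integrable setT
    (EFin \o (fun v => bessel_series a (k * v ^+ 2) * wgauss a s v)) /\
  \int[L]_v (bessel_series a (k * v ^+ 2) * wgauss a s v) =
    s `^ (- a) * expR (- (k / s)).
Proof.
move=> ha s0; have a0 : 0 < a by lra.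
pose T n v := \sum_(0 <= i < n) bessel_gauss_term a k s i v.
pose f v := bessel_series a (k * v ^+ 2) * wgauss a s v.
have mT n : measurable_fun setT (T n).
  by apply: measurable_sum => i; exact: measurable_bessel_gauss_term.
have Tf v : T n v @[n --> \oo] --> f v.
  rewrite (_ : (fun n => T n v) = (fun n => pseries (bessel_coef a) (k * v ^+ 2) n * wgauss a s v)).
    by apply: cvgM; [exact: is_cvg_bessel|exact: cvg_cst].
  apply/funext => n; rewrite /T /pseries /series/= mulr_suml.
  by apply: eq_bigr => i _; rewrite bessel_gauss_termE.
have mf : measurable_fun setT f.
  by apply: (measurable_fun_cvg mT) => v _; exact: Tf.
have [G iG TG] := bessel_gauss_dominated k ha s0.
have iT n : L.-integrable setT (EFin \o T n).
  apply: le_integrable iG => //; first by apply/measurable_EFinP; exact: mT.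
  by move=> v _; apply: le_trans (TG n v) _; exact: lee_abs.
have [||||| fi _ cf] := @dominated_convergence _ _ R L setT measurableT
  (fun n v => (T n v)%:E) (EFin \o f) G.
- by move=> n; apply/measurable_EFinP; apply: mT.
- exact/measurable_EFinP.
- by apply: aeW => v _; apply: cvg_EFin; [apply: nearW => n|exact: Tf].
- exact: iG.
- by apply: aeW => v n _; exact: TG.
split; first exact: fi.
have intT n : \int[L]_v T n v = \sum_(0 <= i < n) s `^ (- a) * exp_coeff (- (k / s)) i.
  have iterm i : L.-integrable setT (EFin \o bessel_gauss_term a k s i).
    by apply: integrable_EFinZ; apply: integrable_wgauss => //; exact: addn_gt0.
  rewrite /Rintegral; under eq_integral do rewrite /T -sumEFin.
  rewrite integral_sum//= -sum_fine; last first.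
    by move=> i _; apply: integrable_fin_num => //; exact: iterm.
  apply: eq_bigr => i _; rewrite -[LHS]/(Rintegral _ _ _) RintegralZl//; last first.
    by apply: integrable_wgauss => //; exact: addn_gt0.
  by rewrite Rintegral_wgauss ?addn_gt0// bessel_gauss_coef.
move: cf; rewrite /= integral_RintegralE// => /fine_cvgP[_ cf].
suff cf' : \int[L]_v T n v @[n --> \oo] --> s `^ (- a) * expR (- (k / s)).
  exact: (cvg_unique _ cf cf').
under eq_cvg => n do rewrite intT -mulr_sumr.
apply: cvgM; first exact: cvg_cst.
exact: is_cvg_series_exp_coeff.
Qed.

End termwise.

(** * Integrals with a power weight *)

Section reflection.
Context {R : realType}.
Implicit Types (f : R -> R).
Set Implicit Arguments.
Unset Strict Implicit.
Local Notation L := (@lebesgue_measure R).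

Lemma Rintegral_reflect f : measurable_fun setT f ->
  \int[L]_v f (- v) = \int[L]_v f v.
Proof.
move=> mf; rewrite /Rintegral; congr fine.
have mEf : measurable_fun setT (EFin \o f) by apply/measurable_EFinP.
have p := ge0_integral_reflect (measurable_funepos mEf) (fun v => funepos_ge0 (EFin \o f) v).
have n := ge0_integral_reflect (measurable_funeneg mEf) (fun v => funeneg_ge0 (EFin \o f) v).
rewrite [LHS]integralE [RHS]integralE -p -n.
by congr (_ - _)%E; apply: eq_integral => v _; rewrite ?funeposE ?funenegE.
Qed.

Lemma Rintegral_odd f : measurable_fun setT f -> L.-integrable setT (EFin \o f) ->
  (forall v, f (- v) = - f v) -> \int[L]_v f v = 0.
Proof.
move=> mf fi oddf.
have : \int[L]_v f v = - \int[L]_v f v.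
  rewrite -{1}Rintegral_reflect// -mulN1r -RintegralZl//.
  by apply: eq_Rintegral => v _; rewrite oddf mulN1r.
lra.
Qed.

End reflection.

Section weighted_integral.
Context {R : realType}.
Implicit Types (f g h : R -> R).
Set Implicit Arguments.
Unset Strict Implicit.
Local Notation L := (@lebesgue_measure R).

Definition weight (a v : R) : R := `|v| `^ (2 * a - 1).

Definition weighted_integrable a f : bool :=
  L.-integrable setT (EFin \o (fun v => f v * weight a v)).

Definition weighted_integral a f : R := \int[L]_v (f v * weight a v).

Context (a : R).
Local Notation wint := (weighted_integrable a).
Local Notation I := (weighted_integral a).

Lemma measurable_weight : measurable_fun setT (weight a).
Proof.
apply: (measurableT_comp (measurable_powR _)).
exact: normr_measurable.
Qed.

Lemma weight_ge0 v : 0 <= weight a v. Proof. exact: powR_ge0. Qed.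

Lemma weightN v : weight a (- v) = weight a v.
Proof. by rewrite /weight normrN. Qed.

Lemma eq_weighted_integrable f g : f =1 g -> wint f -> wint g.
Proof. by move=> /funext ->. Qed.

Lemma eq_weighted_integral f g : f =1 g -> I f = I g.
Proof. by move=> /funext ->. Qed.

Lemma weighted_integrable_dominated f g : measurable_fun setT f -> (forall v, `|f v| <= g v) ->
  wint g -> wint f.
Proof.
move=> mf fg; apply: integrable_dominated.
  exact: measurable_funM mf measurable_weight.
by move=> v; rewrite normrM (ger0_norm (weight_ge0 v)) ler_wpM2r// weight_ge0.
Qed.

Lemma weighted_integrableZ r f : wint f -> wint (fun v => r * f v).
Proof.
move=> /(integrable_EFinZ r); rewrite /weighted_integrable.
by under eq_fun do rewrite mulrA.
Qed.

Lemma weighted_integrableD f g : wint f -> wint g -> wint (fun v => f v + g v).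
Proof.
move=> fi gi; have := integrable_EFinD fi gi; rewrite /weighted_integrable.
by under eq_fun do rewrite -mulrDl.
Qed.

Lemma weighted_integralZ r f : wint f -> I (fun v => r * f v) = r * I f.
Proof.
move=> fi; rewrite /weighted_integral -RintegralZl//.
by apply: eq_Rintegral => v _; rewrite mulrA.
Qed.

Lemma weighted_integralD f g : wint f -> wint g -> I (fun v => f v + g v) = I f + I g.
Proof.
move=> fi gi; rewrite /weighted_integral -RintegralD//.
by apply: eq_Rintegral => v _; rewrite mulrDl.
Qed.

Lemma weighted_integral_ge0 f : (forall v, 0 <= f v) -> 0 <= I f.
Proof. by move=> f0; apply: Rintegral_ge0 => v _; rewrite mulr_ge0// weight_ge0. Qed.

Lemma le_weighted_integral f g : wint f -> wint g -> (forall v, f v <= g v) -> I f <= I g.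
Proof.
move=> fi gi fg; apply: le_Rintegral => // v _.
by rewrite ler_wpM2r ?weight_ge0.
Qed.

Lemma weighted_integrable0 : wint (fun=> 0).
Proof.
by apply: eq_integrable (integrable0 _ _) => // v _ /=; rewrite mul0r.
Qed.

Lemma weighted_integral0 : I (fun=> 0) = 0.
Proof.
rewrite /weighted_integral; under eq_Rintegral do rewrite mul0r.
by rewrite Rintegral_cst// mul0r.
Qed.

Lemma normr_weighted_integral_le f g : wint f -> wint g -> (forall v, `|f v| <= g v) -> `|I f| <= I g.
Proof.
move=> fi gi fg; apply: le_trans (le_normr_Rintegral _ fi) _ => //.
apply: le_Rintegral => //; first exact: integrable_norm.
by move=> v _; rewrite normrM (ger0_norm (weight_ge0 v)) ler_wpM2r// weight_ge0.
Qed.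

Lemma weighted_integral_odd f : measurable_fun setT f -> wint f -> (forall v, f (- v) = - f v) ->
  I f = 0.
Proof.
move=> mf fi oddf; apply: Rintegral_odd => //.
  exact: measurable_funM mf measurable_weight.
by move=> v; rewrite oddf weightN mulNr.
Qed.

Lemma weighted_integrableM f g : measurable_fun setT f -> measurable_fun setT g ->
  wint (fun v => f v ^+ 2) -> wint (fun v => g v ^+ 2) -> wint (fun v => f v * g v).
Proof.
move=> mf mg f2 g2; apply: weighted_integrable_dominated (weighted_integrableD f2 g2).
  exact: measurable_funM.
move=> v; rewrite normrM -(real_normK (num_real (f v))) -(real_normK (num_real (g v))).
set x := `|f v|; set y := `|g v|; have := sqr_ge0 (x - y).
have : 0 <= x * y by rewrite /x /y mulr_ge0.
nra.
Qed.

(** One integrand for the L1 norm and the square of the L2 norm. Approximations are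
needed in both at once: the transform is defined through the first and is isometric
for the second. *)
Definition mixed_norm f : R -> R := fun v => `|f v| + f v ^+ 2.

Definition L1L2 f := measurable_fun setT f /\ wint (mixed_norm f).

Lemma measurable_mixed_norm f : measurable_fun setT f -> measurable_fun setT (mixed_norm f).
Proof.
move=> mf; apply: measurable_funD; first exact: measurableT_comp.
exact: measurable_funX.
Qed.

Lemma mixed_norm_ge0 f v : 0 <= mixed_norm f v.
Proof. by rewrite addr_ge0 ?sqr_ge0. Qed.

Lemma L1L2_dominated f g : measurable_fun setT f -> (forall v, `|f v| <= `|g v|) ->
  L1L2 g -> L1L2 f.
Proof.
move=> mf fg [mg gi]; split=> //; apply: weighted_integrable_dominated gi.
  exact: measurable_mixed_norm.
move=> v; rewrite ger0_norm ?mixed_norm_ge0// lerD//.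
by rewrite -(real_normK (num_real (f v))) -(real_normK (num_real (g v))) lerXn2r// nnegrE.
Qed.

Lemma L1L2_integrable_norm f : L1L2 f -> wint (fun v => `|f v|).
Proof.
move=> [mf]; apply: weighted_integrable_dominated => [|v]; first exact: measurableT_comp.
by rewrite normr_id lerDl sqr_ge0.
Qed.

Lemma L1L2_integrable_sqr f : L1L2 f -> wint (fun v => f v ^+ 2).
Proof.
move=> [mf]; apply: weighted_integrable_dominated => [|v]; first exact: measurable_funX.
by rewrite ger0_norm ?sqr_ge0// lerDr.
Qed.

Lemma L1L2_intro f : measurable_fun setT f -> wint (fun v => `|f v|) ->
  wint (fun v => f v ^+ 2) -> L1L2 f.
Proof. by move=> mf f1 f2; split=> //; exact: weighted_integrableD. Qed.

Lemma L1L2Z r f : L1L2 f -> L1L2 (fun v => r * f v).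
Proof.
move=> fL; have mf := fL.1; apply: L1L2_intro.
- exact: measurable_funM.
- by under eq_fun do rewrite normrM; exact/weighted_integrableZ/L1L2_integrable_norm.
- by under eq_fun do rewrite exprMn; exact/weighted_integrableZ/L1L2_integrable_sqr.
Qed.

(** Replaces the triangle inequality for both norms. *)
Lemma mixed_normD_le f g v :
  mixed_norm (fun v => f v + g v) v <= 2 * mixed_norm f v + 2 * mixed_norm g v.
Proof.
rewrite /mixed_norm.
have h1 : `|f v + g v| <= `|f v| + `|g v| by exact: ler_normD.
have h2 : (f v + g v) ^+ 2 <= 2 * f v ^+ 2 + 2 * g v ^+ 2.
  by have := sqr_ge0 (f v - g v); nra.
have := normr_ge0 (f v); have := normr_ge0 (g v); lra.
Qed.

Lemma L1L2D f g : L1L2 f -> L1L2 g -> L1L2 (fun v => f v + g v).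
Proof.
move=> [mf fi] [mg gi]; split; first exact: measurable_funD.
apply: weighted_integrable_dominated (weighted_integrableD (weighted_integrableZ 2 fi) (weighted_integrableZ 2 gi)).
  by apply: measurable_mixed_norm; exact: measurable_funD.
by move=> v; rewrite ger0_norm ?mixed_norm_ge0// mixed_normD_le.
Qed.

Lemma L1L2B f g : L1L2 f -> L1L2 g -> L1L2 (fun v => f v - g v).
Proof.
move=> fL gL; have := L1L2D fL (L1L2Z (-1) gL).
by under eq_fun do rewrite mulN1r.
Qed.

Lemma L1L2_integrableM f g : L1L2 f -> L1L2 g -> wint (fun v => f v * g v).
Proof.
move=> fL gL; apply: weighted_integrableM; [exact: fL.1|exact: gL.1|exact: L1L2_integrable_sqr..].
Qed.

End weighted_integral.

(** * The real transform of Gaussians *)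

Section hartley_transform.
Context {R : realType}.
Implicit Types (f g h : R -> R).
Set Implicit Arguments.
Unset Strict Implicit.
Context (a : R) (ha : 1 / 2 <= a) (beta : R) (beta0 : beta != 0).
Local Notation wint := (weighted_integrable a).
Local Notation I := (weighted_integral a).

Let a0 : 0 < a. Proof. by move: ha; lra. Qed.

Let ha1 : 1 / 2 <= a + 1. Proof. by move: ha; lra. Qed.

(** The real and imaginary parts of the Dunkl kernel [E (i z)], divided by [Gamma a]. *)
Definition even_kernel (z : R) : R := bessel_series a ((z / 2) ^+ 2).
Definition odd_kernel (z : R) : R := z / 2 * bessel_series (a + 1) ((z / 2) ^+ 2).
(** The analogue of the kernel [cos + sin] of the Hartley transform: it transforms the
even and the odd part of a real function at once, without complex numbers. *)
Definition hartley_kernel (z : R) : R := even_kernel z + odd_kernel z.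

Lemma even_kernelN z : even_kernel (- z) = even_kernel z.
Proof. by rewrite /even_kernel mulNr sqrrN. Qed.

Lemma odd_kernelN z : odd_kernel (- z) = - odd_kernel z.
Proof. by rewrite /odd_kernel !mulNr sqrrN. Qed.

Lemma measurable_bessel_sqr (b : R) : 1 / 2 <= b ->
  measurable_fun setT (fun z : R => bessel_series b ((z / 2) ^+ 2)).
Proof.
move=> hb; have mz : measurable_fun setT (fun z : R => (z / 2) ^+ 2).
  by apply: measurable_funX; exact: measurable_funM.
apply: measurableT_comp mz.
by apply: continuous_measurable_fun; exact: continuous_bessel.
Qed.

Lemma measurable_even_kernel : measurable_fun setT even_kernel.
Proof. exact: measurable_bessel_sqr. Qed.

Lemma measurable_odd_kernel : measurable_fun setT odd_kernel.
Proof.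
apply: measurable_funM; first exact: measurable_funM.
exact: measurable_bessel_sqr.
Qed.

Lemma measurable_hartley_kernel : measurable_fun setT hartley_kernel.
Proof.
by apply: measurable_funD; [exact: measurable_even_kernel|exact: measurable_odd_kernel].
Qed.

Lemma even_kernel_le z : `|even_kernel z| <= (Gamma a)^-1.
Proof.
have [h _] := bessel_series_bound ha (sqr_ge0 (z / 2)).
have G0 := Gamma_gt0 a0.
move: h; rewrite normrM (gtr0_norm G0) mulrC -ler_pdivlMr// div1r.
by [].
Qed.

Lemma odd_kernel_le z : `|odd_kernel z| <= (Gamma a)^-1.
Proof.
have [_ h] := bessel_series_bound ha (sqr_ge0 (z / 2)).
have G0 := Gamma_gt0 a0.
move: h; rewrite normrM (gtr0_norm G0) mulrC -ler_pdivlMr// div1r.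
by rewrite sqrtr_sqr normrM normr_id -normrM.
Qed.

Lemma hartley_kernel_le z : `|hartley_kernel z| <= 2 / Gamma a.
Proof.
apply: le_trans (ler_normD _ _) _; have := even_kernel_le z; have := odd_kernel_le z; lra.
Qed.

(** The factor that makes the transform isometric; the dependence on [beta] compensates
the rescaling of the frequency variable. *)
Definition hartley_const : R := (`|beta| / 2) `^ a.

Definition hartley f w : R :=
  hartley_const * I (fun v => hartley_kernel (beta * w * v) * f v).

Lemma weighted_integrable_kernelM (k f : R -> R) M : measurable_fun setT k ->
  (forall z, `|k z| <= M) -> measurable_fun setT f -> wint (fun v => `|f v|) ->
  wint (fun v => k v * f v).
Proof.
move=> mk kM mf fi; apply: weighted_integrable_dominated (weighted_integrableZ M fi).
  exact: measurable_funM.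
by move=> v; rewrite normrM ler_wpM2r.
Qed.

Lemma measurable_scale (k : R -> R) (c : R) : measurable_fun setT k ->
  measurable_fun setT (fun v : R => k (c * v)).
Proof. by move=> mk; apply: measurableT_comp mk _; exact: measurable_funM. Qed.

Lemma weighted_integrable_hartley f w : L1L2 a f ->
  wint (fun v => hartley_kernel (beta * w * v) * f v).
Proof.
move=> fL; apply: (@weighted_integrable_kernelM _ _ (2 / Gamma a)).
- exact: measurable_scale measurable_hartley_kernel.
- by move=> z; exact: hartley_kernel_le.
- exact: fL.1.
- exact: L1L2_integrable_norm.
Qed.

Lemma hartleyD f g w : L1L2 a f -> L1L2 a g ->
  hartley (fun v => f v + g v) w = hartley f w + hartley g w.
Proof.
move=> fL gL; rewrite /hartley -mulrDr -weighted_integralD; try exact: weighted_integrable_hartley.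
congr (_ * _); apply: eq_weighted_integral => v. by rewrite mulrDr.
Qed.

Lemma hartleyZ r f w : L1L2 a f ->
  hartley (fun v => r * f v) w = r * hartley f w.
Proof.
move=> fL; rewrite /hartley mulrCA -(weighted_integralZ r); last exact: weighted_integrable_hartley.
by congr (_ * _); apply: eq_weighted_integral => v; rewrite mulrCA.
Qed.

Lemma hartley_const_ge0 : 0 <= hartley_const. Proof. exact: powR_ge0. Qed.

Lemma hartley_le f w : L1L2 a f ->
  `|hartley f w| <= hartley_const * (2 / Gamma a) * I (mixed_norm f).
Proof.
move=> fL; rewrite normrM (ger0_norm hartley_const_ge0) -mulrA.
rewrite ler_wpM2l ?hartley_const_ge0//.
have C0 : 0 <= 2 / Gamma a by rewrite divr_ge0 ?Gamma_ge0.
rewrite -(weighted_integralZ (2 / Gamma a)); last exact: fL.2.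
apply: normr_weighted_integral_le; [exact: weighted_integrable_hartley|apply: weighted_integrableZ; exact: fL.2|].
move=> v; rewrite normrM ler_pM ?hartley_kernel_le//.
by rewrite lerDl sqr_ge0.
Qed.

(** The boolean is the parity. *)
Definition bgauss (b : bool) (s v : R) : R := v ^+ b * expR (- s * v ^+ 2).

Lemma measurable_bgauss b s : measurable_fun setT (bgauss b s).
Proof.
apply: measurable_funM; first exact: measurable_funX.
apply: measurableT_comp => //; apply: measurable_funM => //.
Qed.

Lemma bgauss_sqr_weight b s t v :
  bgauss b s v * bgauss b t v * weight a v = wgauss (b%:R + a) (s + t) v.
Proof.
rewrite -(wgauss_exprM _ _ _ ha) /bgauss /wgauss /weight -exprM.
have -> : - (s + t) * v ^+ 2 = - s * v ^+ 2 + - t * v ^+ 2 by ring.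
by rewrite expRD; case: b; rewrite ?muln1 ?muln0 /= ?expr0 ?expr1 ?expr2; ring.
Qed.

Lemma weighted_integrable_bgaussM b s t : 0 < s -> 0 < t ->
  wint (fun v => bgauss b s v * bgauss b t v).
Proof.
move=> s0 t0; rewrite /weighted_integrable.
under eq_fun do rewrite bgauss_sqr_weight.
by apply: integrable_wgauss; [exact: addn_gt0|exact: addr_gt0].
Qed.

Lemma weighted_integral_bgaussM b s t : 0 < s -> 0 < t ->
  I (fun v => bgauss b s v * bgauss b t v) =
  (s + t) `^ (- (b%:R + a)) * Gamma (b%:R + a).
Proof.
move=> s0 t0; rewrite /weighted_integral.
under eq_Rintegral do rewrite bgauss_sqr_weight.
by apply: Rintegral_wgauss; [exact: addn_gt0|exact: addr_gt0].
Qed.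

Lemma L1L2_bgauss b s : 0 < s -> L1L2 a (bgauss b s).
Proof.
move=> s0; apply: L1L2_intro; first exact: measurable_bgauss.
- have s20 : 0 < s / 2 by rewrite divr_gt0.
  (* By [2 x <= 1 + x ^+ 2], [|v ^+ b| * E ^+ 2] is at most the sum of the two
     squares [E ^+ 2] and [(v ^+ b * E) ^+ 2], where [E] has parameter [s / 2]. *)
  have h0 := weighted_integrable_bgaussM false s20 s20.
  have hb := weighted_integrable_bgaussM b s20 s20.
  apply: weighted_integrable_dominated (weighted_integrableD h0 hb).
    by apply: measurableT_comp => //; exact: measurable_bgauss.
  move=> v; rewrite normr_id.
  have e : expR (- s * v ^+ 2) = expR (- (s / 2) * v ^+ 2) ^+ 2.
    by rewrite -expRM_natl; congr expR; field.
  rewrite /bgauss normrM e (ger0_norm (sqr_ge0 _)).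
  set E := expR _; rewrite expr0 mul1r -expr2.
  have -> : v ^+ b * E * (v ^+ b * E) = `|v ^+ b| ^+ 2 * E ^+ 2.
    by rewrite real_normK ?num_real//; ring.
  set x := `|_|.
  have x0 : 0 <= x by rewrite /x.
  have := sqr_ge0 E; nra.
- by under eq_fun do rewrite expr2; exact: weighted_integrable_bgaussM.
Qed.

Lemma weighted_integral_bgauss_mixed s t : 0 < s -> 0 < t ->
  I (fun v => bgauss true s v * bgauss false t v) = 0.
Proof.
move=> s0 t0; apply: weighted_integral_odd.
- by apply: measurable_funM; exact: measurable_bgauss.
- by apply: L1L2_integrableM; exact: L1L2_bgauss.
- by move=> v; rewrite /bgauss !expr1 !expr0 sqrrN; ring.
Qed.

(** The odd part of the kernel contributes an odd integrand. *)
Lemma hartley_bgauss_even s w : 0 < s ->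
  I (fun v => hartley_kernel (beta * w * v) * bgauss false s v) =
  s `^ (- a) * expR (- ((beta * w / 2) ^+ 2 / s)).
Proof.
move=> s0; have gL := L1L2_bgauss false s0.
have mg := measurable_bgauss false s; have g1 := L1L2_integrable_norm gL.
have ie : wint (fun v => even_kernel (beta * w * v) * bgauss false s v).
  apply: (@weighted_integrable_kernelM _ _ (Gamma a)^-1) => //.
    exact: measurable_scale measurable_even_kernel.
  by move=> z; exact: even_kernel_le.
have mo : measurable_fun setT (fun v => odd_kernel (beta * w * v)).
  exact: measurable_scale measurable_odd_kernel.
have io : wint (fun v => odd_kernel (beta * w * v) * bgauss false s v).
  by apply: (@weighted_integrable_kernelM _ _ (Gamma a)^-1) => // z; exact: odd_kernel_le.
rewrite (@eq_weighted_integral _ _ _ (fun v => even_kernel (beta * w * v) * bgauss false s v +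
  odd_kernel (beta * w * v) * bgauss false s v)); last by move=> v; rewrite -mulrDl.
rewrite weighted_integralD// [X in _ + X]weighted_integral_odd ?addr0//; last 2 first.
- exact: measurable_funM.
- by move=> v; rewrite mulrN odd_kernelN /bgauss !expr0 sqrrN; ring.
have [_ <-] := integral_bessel_gauss ((beta * w / 2) ^+ 2) ha s0.
apply: eq_Rintegral => v _; rewrite /even_kernel /bgauss /wgauss expr0 mul1r.
have -> : (beta * w * v / 2) ^+ 2 = (beta * w / 2) ^+ 2 * v ^+ 2 by field.
by rewrite -mulrA; congr (_ * _); rewrite mulrC.
Qed.

Lemma hartley_bgauss_odd s w : 0 < s ->
  I (fun v => hartley_kernel (beta * w * v) * bgauss true s v) =
  beta * w / 2 * (s `^ (- (a + 1)) * expR (- ((beta * w / 2) ^+ 2 / s))).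
Proof.
move=> s0; have gL := L1L2_bgauss true s0.
have mg := measurable_bgauss true s; have g1 := L1L2_integrable_norm gL.
have me : measurable_fun setT (fun v => even_kernel (beta * w * v)).
  exact: measurable_scale measurable_even_kernel.
have ie : wint (fun v => even_kernel (beta * w * v) * bgauss true s v).
  by apply: (@weighted_integrable_kernelM _ _ (Gamma a)^-1) => // z; exact: even_kernel_le.
have io : wint (fun v => odd_kernel (beta * w * v) * bgauss true s v).
  apply: (@weighted_integrable_kernelM _ _ (Gamma a)^-1) => //.
    exact: measurable_scale measurable_odd_kernel.
  by move=> z; exact: odd_kernel_le.
rewrite (@eq_weighted_integral _ _ _ (fun v => even_kernel (beta * w * v) * bgauss true s v +
  odd_kernel (beta * w * v) * bgauss true s v)); last by move=> v; rewrite -mulrDl.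
rewrite weighted_integralD// [X in X + _]weighted_integral_odd ?add0r//; last 2 first.
- exact: measurable_funM.
- by move=> v; rewrite mulrN even_kernelN /bgauss !expr1 sqrrN; ring.
have [ib <-] := integral_bessel_gauss ((beta * w / 2) ^+ 2) ha1 s0.
rewrite -RintegralZl//; apply: eq_Rintegral => v _.
have -> : wgauss (a + 1) s v = v ^+ 2 * wgauss a s v.
  by rewrite addrC -(wgauss_exprM s v 1 ha) expr1.
rewrite /odd_kernel /bgauss /wgauss /weight !expr1.
have -> : (beta * w * v / 2) ^+ 2 = (beta * w / 2) ^+ 2 * v ^+ 2 by field.
by field.
Qed.

Definition gauss_scale : R := (beta / 2) ^+ 2.

Lemma gauss_scale_gt0 : 0 < gauss_scale.
Proof. by rewrite exprn_even_gt0//= mulf_neq0// invr_eq0. Qed.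

Lemma hartley_const_sqr : hartley_const ^+ 2 = gauss_scale `^ a.
Proof.
have -> : gauss_scale = (`|beta| / 2) ^+ 2.
  by rewrite /gauss_scale !exprMn real_normK ?num_real.
have b0 : 0 <= `|beta| / 2 by rewrite divr_ge0.
by rewrite /hartley_const -(powR_mulrn 2 b0) -powRrM [2%:R * a]mulrC powRrM powR_mulrn ?powR_ge0.
Qed.

Lemma hartley_bgauss b s w : 0 < s ->
  hartley (bgauss b s) w =
  hartley_const * (beta / 2) ^+ b * s `^ (- (b%:R + a)) * bgauss b (gauss_scale / s) w.
Proof.
move=> s0; rewrite /hartley.
have e : expR (- ((beta * w / 2) ^+ 2 / s)) = expR (- (gauss_scale / s) * w ^+ 2).
  by congr expR; rewrite /gauss_scale; field; rewrite gt_eqF.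
case: b.
  rewrite hartley_bgauss_odd// e /bgauss !expr1 [a + 1]addrC.
  by rewrite -[1 in LHS]/(1%:R); field.
by rewrite hartley_bgauss_even// e /bgauss !expr0 add0r; ring.
Qed.

Lemma L1L2_hartley_bgauss b s : 0 < s -> L1L2 a (hartley (bgauss b s)).
Proof.
move=> s0; rewrite (_ : hartley _ = (fun w => hartley_const * (beta / 2) ^+ b *
    s `^ (- (b%:R + a)) * bgauss b (gauss_scale / s) w)).
  by apply: L1L2Z; apply: L1L2_bgauss; rewrite divr_gt0// gauss_scale_gt0.
by apply/funext => w; rewrite hartley_bgauss.
Qed.

Lemma powR_harmonic (q s t x : R) : 0 < q -> 0 < s -> 0 < t ->
  (q / s + q / t) `^ (- x) = q `^ (- x) * (s + t) `^ (- x) * (s `^ x * t `^ x).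
Proof.
move=> q0 s0 t0; have st0 : 0 < s + t by exact: addr_gt0.
have inv (y : R) : 0 < y -> (y^-1) `^ (- x) = y `^ x.
  by move=> y0; rewrite -powR_inv1 ?ltW// -powRrM mulN1r opprK.
have -> : q / s + q / t = q * (s + t) * (s^-1 * t^-1) by field; rewrite !gt_eqF.
rewrite powRM ?mulr_ge0 ?invr_ge0 ?ltW// powRM ?ltW//.
by rewrite powRM ?invr_ge0 ?ltW// !inv.
Qed.

(** Parameters [s] and [t] become [q / s] and [q / t] with [q = gauss_scale beta], and
[q / s + q / t = q * (s + t) / (s * t)]: the powers of [s], [t] and [q] cancel. *)
Lemma hartley_bgauss_parseval b s c t : 0 < s -> 0 < t ->
  I (fun w => hartley (bgauss b s) w * hartley (bgauss c t) w) =
  I (fun v => bgauss b s v * bgauss c t v).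
Proof.
move=> s0 t0; have q0 := gauss_scale_gt0.
have qs0 : 0 < gauss_scale / s by exact: divr_gt0.
have qt0 : 0 < gauss_scale / t by exact: divr_gt0.
set C := hartley_const * (beta / 2) ^+ b * s `^ (- (b%:R + a)).
set D := hartley_const * (beta / 2) ^+ c * t `^ (- (c%:R + a)).
rewrite (@eq_weighted_integral _ _ _ (fun w => C * D *
   (bgauss b (gauss_scale / s) w * bgauss c (gauss_scale / t) w))); last first.
  by move=> w; rewrite !hartley_bgauss//; rewrite /C /D; ring.
rewrite weighted_integralZ; last by apply: L1L2_integrableM; exact: L1L2_bgauss.
have [bc|] := eqVneq b c.
  rewrite /C /D; subst c; rewrite !weighted_integral_bgaussM// powR_harmonic//.
  set x := b%:R + a.
  have hq : hartley_const ^+ 2 * ((beta / 2) ^+ b) ^+ 2 * gauss_scale `^ (- x) = 1.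
    rewrite hartley_const_sqr -exprM mulnC exprM -/gauss_scale.
    rewrite -powR_mulrn ?(ltW q0)// -!powRD ?(gt_eqF q0) ?implybT//.
    by rewrite /x (_ : a + b%:R - (b%:R + a) = 0) ?powRr0//; ring.
  have hN (y : R) : 0 < y -> y `^ (- x) * y `^ x = 1.
    by move=> y0; rewrite -powRD ?(gt_eqF y0) ?implybT// addNr powRr0.
  have hs := hN _ s0; have ht := hN _ t0.
  transitivity (hartley_const ^+ 2 * ((beta / 2) ^+ b) ^+ 2 * gauss_scale `^ (- x) *
    (s `^ (- x) * s `^ x) * (t `^ (- x) * t `^ x) * ((s + t) `^ (- x) * Gamma x)).
    ring.
  by rewrite hq hs ht !mul1r.
case: b C; case: c D => // C D _.
  by rewrite !weighted_integral_bgauss_mixed// mulr0.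
have mixed x y : 0 < x -> 0 < y -> I (fun v => bgauss false x v * bgauss true y v) = 0.
  move=> x0 y0; rewrite -(weighted_integral_bgauss_mixed y0 x0).
  by apply: eq_weighted_integral => v; rewrite mulrC.
by rewrite !mixed// mulr0.
Qed.

End hartley_transform.

(** * The span of Gaussians and its closure *)

Section gaussian_span.
Context {R : realType}.
Implicit Types (f g h phi chi : R -> R).
Set Implicit Arguments.
Unset Strict Implicit.

Inductive gauss_span : (R -> R) -> Prop :=
| gauss_span0 : gauss_span (fun=> 0)
| gauss_span_cons r b s phi : 0 < s -> gauss_span phi ->
    gauss_span (fun v => r * bgauss b s v + phi v).

Lemma gauss_spanD phi chi : gauss_span phi -> gauss_span chi ->
  gauss_span (fun v => phi v + chi v).
Proof.
elim=> [|r b s phi' s0 _ IH] chiS; first by under eq_fun do rewrite add0r.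
by under eq_fun do rewrite -addrA; apply: gauss_span_cons => //; exact: IH.
Qed.

Lemma gauss_spanZ r phi : gauss_span phi -> gauss_span (fun v => r * phi v).
Proof.
elim=> [|c b s phi' s0 _ IH].
  by under eq_fun do rewrite mulr0; exact: gauss_span0.
by under eq_fun do rewrite mulrDr mulrA; exact: gauss_span_cons.
Qed.

Lemma gauss_span_bgauss b s : 0 < s -> gauss_span (bgauss b s).
Proof.
move=> s0; have := gauss_span_cons 1 b s0 gauss_span0.
by under eq_fun do rewrite mul1r addr0.
Qed.

Context (a : R) (ha : 1 / 2 <= a) (beta : R) (beta0 : beta != 0).
Local Notation wint := (weighted_integrable a).
Local Notation I := (weighted_integral a).
Local Notation H := (hartley a beta).

Lemma gauss_span_L1L2 phi : gauss_span phi -> L1L2 a phi.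
Proof.
elim=> [|r b s phi' s0 _ IH].
  by apply: L1L2_intro => //; rewrite ?normr0 ?expr0n; exact: weighted_integrable0.
by apply: L1L2D => //; apply: L1L2Z; exact: L1L2_bgauss.
Qed.

Lemma hartley0 w : H (fun=> 0) w = 0.
Proof.
rewrite /hartley (_ : I _ = 0) ?mulr0// -[RHS](weighted_integral0 a).
by apply: eq_weighted_integral => v; rewrite mulr0.
Qed.

Lemma hartley_gauss_span_cons r b s phi w : 0 < s -> gauss_span phi ->
  H (fun v => r * bgauss b s v + phi v) w = r * H (bgauss b s) w + H phi w.
Proof.
move=> s0 pS; have gL := L1L2_bgauss ha b s0.
by rewrite hartleyD ?hartleyZ//; [exact: L1L2Z|exact: gauss_span_L1L2].
Qed.

Lemma gauss_span_L1L2_hartley phi : gauss_span phi -> L1L2 a (H phi).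
Proof.
elim=> [|r b s phi' s0 pS IH].
  rewrite (_ : H _ = fun=> 0); last by apply/funext => w; exact: hartley0.
  exact: gauss_span_L1L2 gauss_span0.
rewrite (_ : H _ = fun w => r * H (bgauss b s) w + H phi' w).
  by apply: L1L2D => //; apply: L1L2Z; exact: L1L2_hartley_bgauss.
by apply/funext => w; exact: hartley_gauss_span_cons.
Qed.

Lemma hartley_span_bgauss_parseval phi b s : gauss_span phi -> 0 < s ->
  I (fun w => H phi w * H (bgauss b s) w) = I (fun v => phi v * bgauss b s v).
Proof.
move=> pS s0; have gL := L1L2_bgauss ha b s0.
have HgL := L1L2_hartley_bgauss ha beta0 b s0.
elim: pS => [|r c t phi' t0 pS IH].
  by apply: eq_weighted_integral => v; rewrite hartley0 !mul0r.
have uL := L1L2_bgauss ha c t0; have HuL := L1L2_hartley_bgauss ha beta0 c t0.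
have pL := gauss_span_L1L2 pS; have HpL := gauss_span_L1L2_hartley pS.
transitivity (r * I (fun w => H (bgauss c t) w * H (bgauss b s) w) +
              I (fun w => H phi' w * H (bgauss b s) w)).
  rewrite -weighted_integralZ ?L1L2_integrableM// -weighted_integralD; [|by apply: weighted_integrableZ; exact: L1L2_integrableM|exact: L1L2_integrableM].
  by apply: eq_weighted_integral => w; rewrite hartley_gauss_span_cons// mulrDl mulrA.
rewrite IH hartley_bgauss_parseval//.
rewrite -weighted_integralZ ?L1L2_integrableM// -weighted_integralD; [|by apply: weighted_integrableZ; exact: L1L2_integrableM|exact: L1L2_integrableM].
by apply: eq_weighted_integral => w; rewrite mulrDl mulrA.
Qed.

Lemma hartley_span_parseval phi chi : gauss_span phi -> gauss_span chi ->
  I (fun w => H phi w * H chi w) = I (fun v => phi v * chi v).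
Proof.
move=> pS; have pL := gauss_span_L1L2 pS; have HpL := gauss_span_L1L2_hartley pS.
elim=> [|r c t chi' t0 cS IH].
  by apply: eq_weighted_integral => v; rewrite hartley0 !mulr0.
have uL := L1L2_bgauss ha c t0; have HuL := L1L2_hartley_bgauss ha beta0 c t0.
have cL := gauss_span_L1L2 cS; have HcL := gauss_span_L1L2_hartley cS.
transitivity (r * I (fun w => H phi w * H (bgauss c t) w) +
              I (fun w => H phi w * H chi' w)).
  rewrite -weighted_integralZ ?L1L2_integrableM// -weighted_integralD; [|by apply: weighted_integrableZ; exact: L1L2_integrableM|exact: L1L2_integrableM].
  by apply: eq_weighted_integral => w; rewrite hartley_gauss_span_cons// mulrDr mulrCA.
rewrite IH hartley_span_bgauss_parseval//.
rewrite -weighted_integralZ ?L1L2_integrableM// -weighted_integralD; [|by apply: weighted_integrableZ; exact: L1L2_integrableM|exact: L1L2_integrableM].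
by apply: eq_weighted_integral => w; rewrite mulrDr mulrCA.
Qed.

Lemma hartley_span_isometry phi : gauss_span phi ->
  I (fun w => H phi w ^+ 2) = I (fun v => phi v ^+ 2).
Proof. by move=> pS; exact: hartley_span_parseval. Qed.

End gaussian_span.

Section density.
Context {R : realType}.
Implicit Types (f g h phi : R -> R).
Set Implicit Arguments.
Unset Strict Implicit.
Context (a : R) (ha : 1 / 2 <= a).
Local Notation wint := (weighted_integrable a).
Local Notation I := (weighted_integral a).

Definition approximable g := L1L2 a g /\
  forall e : R, 0 < e -> exists2 phi, gauss_span phi &
    I (mixed_norm (fun v => g v - phi v)) < e.

Lemma approximable_span phi : gauss_span phi -> approximable phi.
Proof.
move=> pS; split; first exact: gauss_span_L1L2.
move=> e e0; exists phi => //.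
rewrite (_ : I _ = 0)// -[RHS](weighted_integral0 a); apply: eq_weighted_integral => v.
by rewrite /mixed_norm subrr normr0 expr0n addr0.
Qed.

Lemma weighted_integral_mixed_normD_le f g : L1L2 a f -> L1L2 a g ->
  I (mixed_norm (fun v => f v + g v)) <=
  2 * I (mixed_norm f) + 2 * I (mixed_norm g).
Proof.
move=> fL gL; rewrite -weighted_integralZ -?weighted_integralZ; [|exact: gL.2|exact: fL.2].
rewrite -weighted_integralD; [|apply: weighted_integrableZ; exact: fL.2|apply: weighted_integrableZ; exact: gL.2].
apply: le_weighted_integral.
- exact: (L1L2D fL gL).2.
- by apply: weighted_integrableD; apply: weighted_integrableZ; [exact: fL.2|exact: gL.2].
- by move=> v; exact: mixed_normD_le.
Qed.

Lemma approximableD f g : approximable f -> approximable g ->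
  approximable (fun v => f v + g v).
Proof.
move=> [fL fA] [gL gA]; split; first exact: L1L2D.
move=> e e0; have e4 : 0 < e / 4 by rewrite divr_gt0.
have [p pS pe] := fA _ e4; have [q qS qe] := gA _ e4.
have pL := gauss_span_L1L2 ha pS; have qL := gauss_span_L1L2 ha qS.
exists (fun v => p v + q v); first exact: gauss_spanD.
rewrite (_ : (fun v => _) = fun v => (f v - p v) + (g v - q v)); last first.
  by apply/funext => v; ring.
apply: le_lt_trans (weighted_integral_mixed_normD_le (L1L2B fL pL) (L1L2B gL qL)) _; lra.
Qed.

Lemma mixed_normZ_le r f v :
  mixed_norm (fun v => r * f v) v <= (`|r| + r ^+ 2) * mixed_norm f v.
Proof.
rewrite /mixed_norm normrM exprMn.
have := normr_ge0 r; have := normr_ge0 (f v); have := sqr_ge0 r; have := sqr_ge0 (f v).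
set x := `|r|; set y := `|f v|; set z := r ^+ 2; set t := f v ^+ 2; nra.
Qed.

Lemma approximableZ r f : approximable f -> approximable (fun v => r * f v).
Proof.
move=> [fL fA]; split; first exact: L1L2Z.
move=> e e0; set C := `|r| + r ^+ 2.
have C0 : 0 <= C by rewrite addr_ge0 ?sqr_ge0.
have eC : 0 < e / (C + 1) by rewrite divr_gt0// ltr_wpDl.
have [p pS pe] := fA _ eC; have pL := gauss_span_L1L2 ha pS.
have fpL := L1L2B fL pL.
exists (fun v => r * p v); first exact: gauss_spanZ.
apply: (@le_lt_trans _ _ (C * I (mixed_norm (fun v => f v - p v)))).
  rewrite -weighted_integralZ; last exact: fpL.2.
  apply: le_weighted_integral.
  - exact: (L1L2B (L1L2Z r fL) (L1L2Z r pL)).2.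
  - by apply: weighted_integrableZ; exact: fpL.2.
  - by move=> v; rewrite /mixed_norm -mulrBr; exact: mixed_normZ_le.
move: pe; rewrite ltr_pdivlMr ?ltr_wpDl// => /(le_lt_trans _); apply.
rewrite mulrC ler_wpM2l ?lerDl//.
by apply: weighted_integral_ge0 => v; exact: mixed_norm_ge0.
Qed.

Lemma approximableB f g : approximable f -> approximable g ->
  approximable (fun v => f v - g v).
Proof.
move=> fA gA; have := approximableD fA (approximableZ (-1) gA).
by under eq_fun do rewrite mulN1r.
Qed.

(** Dominated convergence for both norms. Every approximation below is an instance of
this closure property. *)
Lemma approximable_lim (g_ : (R -> R)^nat) g G :
  (forall n, approximable (g_ n)) -> measurable_fun setT g ->
  (forall v, v != 0 -> g_ n v @[n --> \oo] --> g v) ->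
  L1L2 a G -> (forall n v, `|g_ n v| <= G v) -> (forall v, `|g v| <= G v) ->
  approximable g.
Proof.
move=> g_A mg g_g GL g_G gG.
have G0 v : 0 <= G v by apply: le_trans (gG v).
have gL : L1L2 a g.
  by apply: L1L2_dominated GL => // v; rewrite (ger0_norm (G0 v)).
split=> // e e0.
have mg_ n : measurable_fun setT (g_ n) := (g_A n).1.1.
pose d n v := mixed_norm (fun u => g v - g_ n v) v * weight a v.
have md n : measurable_fun setT (fun v => mixed_norm (fun v => g v - g_ n v) v * weight a v).
  apply: measurable_funM; last exact: measurable_weight.
  by apply: measurable_mixed_norm; exact: measurable_funB.
have [||||| _ cI] := @dominated_convergence_punctured R
  (fun n v => mixed_norm (fun v => g v - g_ n v) v * weight a v) (fun=> 0)
  (fun v => (2 * mixed_norm G v + 2 * mixed_norm G v) * weight a v).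
- exact: md.
- by [].
- move=> v v0.
  have c : g v - g_ n v @[n --> \oo] --> 0.
    by rewrite -(subrr (g v)); apply: cvgB; [exact: cvg_cst|exact: g_g].
  rewrite -(mul0r (weight a v)); apply: cvgM; last exact: cvg_cst.
  rewrite -[X in _ --> X]addr0; apply: cvgD.
    by rewrite -(@normr0 _ R); exact: cvg_norm.
  rewrite -[X in _ --> X](mulr0 0); exact: (cvgM c c).
- by apply: weighted_integrableD; apply: weighted_integrableZ; exact: GL.2.
- move=> n v; rewrite normrM (ger0_norm (weight_ge0 a v)).
  rewrite ler_wpM2r ?weight_ge0// ger0_norm ?mixed_norm_ge0//.
  apply: le_trans (mixed_normD_le g (fun v => - g_ n v) v) _.
  rewrite lerD// ler_pM2l//; apply: lerD.
  + by rewrite (ger0_norm (G0 v)).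
  + by rewrite -(real_normK (num_real (g v))) lerXn2r// nnegrE.
  + by rewrite normrN (ger0_norm (G0 v)).
  + by rewrite sqrrN -(real_normK (num_real (g_ n v))) lerXn2r// nnegrE.
have e4 : 0 < e / 4 by rewrite divr_gt0.
have : \forall n \near \oo, I (mixed_norm (fun v => g v - g_ n v)) < e / 4.
  rewrite Rintegral_cst// mul0r in cI.
  by apply: (cvgr_lt _ cI).
move=> [N _ /(_ N (leqnn N)) /= hN].
have [p pS pe] := (g_A N).2 _ e4; have pL := gauss_span_L1L2 ha pS.
exists p => //.
rewrite (_ : (fun v => _) = fun v => (g v - g_ N v) + (g_ N v - p v)); last first.
  by apply/funext => v; ring.
have g_L := (g_A N).1.
apply: le_lt_trans (weighted_integral_mixed_normD_le (L1L2B gL g_L) (L1L2B g_L pL)) _; lra.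
Qed.

End density.

(** * Density of Gaussians *)

Section gaussian_density.
Context {R : realType}.
Implicit Types (f g h k : R -> R) (r s t v x y : R).
Set Implicit Arguments.
Unset Strict Implicit.

Lemma bernoulli_sub (y : R) n : 0 <= y <= 1 -> 1 - n%:R * y <= (1 - y) ^+ n.
Proof.
move=> /andP[y0 y1]; elim: n => [|n IH]; first by rewrite mul0r subr0 expr0.
have y1' : 0 <= 1 - y by rewrite subr_ge0.
rewrite exprS -natr1; apply: le_trans (ler_wpM2l y1' IH).
have : 0 <= n%:R * y * y by rewrite !mulr_ge0.
lra.
Qed.

Lemma expRN_le_inv_sqr (z : R) : 0 < z -> expR (- z) <= 2 / z ^+ 2.
Proof.
move=> z0; have z2 : 0 < 2 / z ^+ 2 by rewrite divr_gt0 ?exprn_gt0.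
rewrite expRN -[leRHS]invrK lef_pV2 ?posrE ?expR_gt0 ?invr_gt0//.
rewrite invf_div; apply: le_trans (expR_ge1Dxn 1 (ltW z0)).
by rewrite factE /= lerDr.
Qed.

(** With [y = expR (- m * x)], [m = n.+1], the power [(1 - y) ^+ N] passes from 0 to 1
where [N * y] passes from large to small values. An exponent close to
[m * expR (m * r)] places the transition at [x = r], and the factor [m] makes the
limit vanish at [x = r] itself. *)
Definition ray_exponent r n : nat :=
  (Num.trunc (n.+1%:R * expR (n.+1%:R * r))).+1.

Definition ray_approx r n x : R :=
  (1 - expR (- n.+1%:R * x)) ^+ ray_exponent r n.

Lemma ray_approx_itv r n x : 0 <= x -> 0 <= ray_approx r n x <= 1.
Proof.
move=> x0; have e0 := expR_ge0 (- n.+1%:R * x).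
have e1 : expR (- n.+1%:R * x) <= 1 by rewrite expR_le1 mulNr oppr_le0 mulr_ge0.
have h1 : 0 <= 1 - expR (- n.+1%:R * x) by rewrite subr_ge0.
by rewrite /ray_approx exprn_ge0//= exprn_ile1// gerBl.
Qed.

Lemma ray_approx_above r n x : 0 < x -> r < x ->
  1 - (2 / (x - r) ^+ 2 + 2 / x ^+ 2) * n.+1%:R^-1 <= ray_approx r n x.
Proof.
move=> x0 rx; set m : R := n.+1%:R; have m0 : 0 < m by rewrite /m.
set N := ray_exponent r n; set y := expR (- m * x).
have d0 : 0 < x - r by rewrite subr_gt0.
have hy : 0 <= y <= 1 by rewrite expR_ge0 expR_le1 mulNr oppr_le0 mulr_ge0 ?ltW.
apply: le_trans (bernoulli_sub N hy); rewrite lerD2l lerN2.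
have hN : N%:R <= m * expR (m * r) + 1.
  rewrite /N /ray_exponent -natr1 lerD2r.
  by rewrite truncn_le mulr_ge0 ?expR_ge0.
have y0 : 0 <= y by case/andP: hy.
apply: le_trans (ler_wpM2r y0 hN) _.
rewrite mulrDl mul1r [leRHS]mulrDl; apply: lerD.
  (* The bound [2 / z ^+ 2] of [expR (- z)] absorbs the factor [m]. *)
  have -> : m * expR (m * r) * y = m * expR (- (m * (x - r))).
    by rewrite -mulrA -expRD; congr (_ * expR _); ring.
  have := expRN_le_inv_sqr (mulr_gt0 m0 d0) => /(ler_wpM2l (ltW m0)) /le_trans; apply.
  rewrite le_eqVlt; apply/orP; left; apply/eqP; field.
  by rewrite !gt_eqF.
rewrite /y mulNr; apply: le_trans (expRN_le_inv_sqr (mulr_gt0 m0 x0)) _.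
rewrite exprMn invfM mulrCA mulrC ler_wpM2l ?divr_ge0 ?sqr_ge0//.
rewrite lef_pV2 ?posrE ?exprn_gt0// expr2.
by apply: ler_peMl; [exact: ltW|rewrite /m ler1n].
Qed.

Lemma ray_approx_below r n x : x <= r -> 0 <= x ->
  ray_approx r n x <= n.+1%:R^-1.
Proof.
move=> xr x0; set m : R := n.+1%:R; have m0 : 0 < m by rewrite /m.
rewrite /ray_approx -/m; set N := ray_exponent r n; set y := expR (- m * x).
have y1 : 0 <= 1 - y.
  by rewrite subr_ge0 expR_le1 mulNr oppr_le0 mulr_ge0 ?(ltW m0).
apply: (@le_trans _ _ (expR (- y) ^+ N)).
  by apply: lerXn2r; rewrite ?nnegrE ?expR_ge0 ?expR_ge1Dx.
rewrite -expRM_natl mulrN expRN lef_pV2 ?posrE ?expR_gt0//.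
apply: (@le_trans _ _ (1 + N%:R * y)); last exact: expR_ge1Dx.
have hN : m * expR (m * r) <= N%:R by apply/ltW; exact: truncnS_gt.
apply: (@le_trans _ _ (N%:R * y)); last by rewrite lerDr.
apply: le_trans (ler_wpM2r (expR_ge0 _) hN); rewrite -mulrA -expRD.
rewrite ler_peMr ?(ltW m0)// -expR0 ler_expR mulNr -mulrBr.
by rewrite mulr_ge0 ?subr_ge0// ltW.
Qed.

Lemma cvg_ray_approx r x : 0 < x ->
  ray_approx r n x @[n --> \oo] --> (\1_(`]r, +oo[%classic) x : R).
Proof.
move=> x0; rewrite indicE.
have ch : @harmonic R n @[n --> \oo] --> 0 by exact: cvg_harmonic.
have [rx|xr] := ltP r x.
  have -> : x \in `]r, +oo[%classic by rewrite inE/= in_itv/= rx.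
  apply: (@squeeze_cvgr _ _ _ _
    (fun n => 1 - (2 / (x - r) ^+ 2 + 2 / x ^+ 2) * n.+1%:R^-1) (fun=> 1)).
  - near=> n; rewrite ray_approx_above//=.
    by have /andP[] := ray_approx_itv r n (ltW x0).
  - rewrite -[X in _ --> X]subr0; apply: cvgB; first exact: cvg_cst.
    rewrite -(mulr0 (2 / (x - r) ^+ 2 + 2 / x ^+ 2)); apply: cvgM => //.
    exact: cvg_cst.
  - exact: cvg_cst.
have -> : x \in `]r, +oo[%classic = false.
  by apply/negbTE; rewrite notin_setE/= in_itv/= andbT; apply/negP; rewrite -leNgt.
apply: (@squeeze_cvgr _ _ _ _ (fun=> 0) (@harmonic R)).
- near=> n; have /andP[-> _] /= := ray_approx_itv r n (ltW x0).
  by apply: ray_approx_below => //; exact: ltW.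
- exact: cvg_cst.
- exact: ch.
Unshelve. all: by end_near. Qed.

Context (a : R) (ha : 1 / 2 <= a).

Lemma bgaussM_expR b s t v : bgauss b s v * expR (- t * v ^+ 2) = bgauss b (s + t) v.
Proof. by rewrite /bgauss -mulrA -expRD; congr (_ * expR _); ring. Qed.

(** Multiplication by [expR (- t * v ^+ 2)] only changes the parameter of a Gaussian. *)
Lemma approximable_bgauss_pow b s t n : 0 < s -> 0 < t ->
  approximable a (fun v => bgauss b s v * (1 - expR (- t * v ^+ 2)) ^+ n).
Proof.
move=> s0 t0; elim: n s s0 => [|n IH] s s0.
  under eq_fun do rewrite expr0 mulr1.
  exact/approximable_span/gauss_span_bgauss.
rewrite (_ : (fun v => _) = fun v =>
    bgauss b s v * (1 - expR (- t * v ^+ 2)) ^+ n -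
    bgauss b (s + t) v * (1 - expR (- t * v ^+ 2)) ^+ n).
  by apply: approximableB => //; apply: IH => //; exact: addr_gt0.
by apply/funext => v; rewrite -bgaussM_expR exprS; ring.
Qed.

(** Functions of [v ^+ 2] that may multiply a Gaussian of given parity. They are stable
under linear combinations and bounded limits, so that a monotone class argument
applies to them. *)
Definition multiplier b k := approximable a (fun v => bgauss b 1 v * k (v ^+ 2)).

Lemma measurable_bgaussM b k : measurable_fun setT k ->
  measurable_fun setT (fun v => bgauss b 1 v * k (v ^+ 2)).
Proof.
move=> mk; apply: measurable_funM; first exact: measurable_bgauss.
by apply: measurableT_comp mk _; exact: measurable_funX.
Qed.

Lemma multiplier_lim b (k_ : (R -> R)^nat) k M :
  (forall n, multiplier b (k_ n)) -> measurable_fun setT k ->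
  (forall x, 0 < x -> k_ n x @[n --> \oo] --> k x) ->
  (forall n x, 0 <= x -> `|k_ n x| <= M) -> (forall x, 0 <= x -> `|k x| <= M) ->
  multiplier b k.
Proof.
move=> kA mk kk k_M kM.
have M0 : 0 <= M by apply: le_trans (kM 0 (lexx _)).
apply: (@approximable_lim _ _ ha (fun n v => bgauss b 1 v * k_ n (v ^+ 2)) _
    (fun v => `|M * bgauss b 1 v|)).
- exact: kA.
- exact: measurable_bgaussM.
- move=> v v0; apply: cvgM; first exact: cvg_cst.
  by apply: kk; rewrite exprn_even_gt0.
- have gL := L1L2Z M (L1L2_bgauss ha b ltr01); have mg := gL.1.
  by apply: L1L2_dominated gL => [|v]; [exact: measurableT_comp|rewrite normr_id].
- by move=> n v; rewrite mulrC !normrM (ger0_norm M0) ler_wpM2r// k_M// sqr_ge0.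
- by move=> v; rewrite mulrC !normrM (ger0_norm M0) ler_wpM2r// kM// sqr_ge0.
Qed.

Lemma multiplierD b k h : multiplier b k -> multiplier b h ->
  multiplier b (fun x => k x + h x).
Proof.
by move=> kA hA; have := approximableD ha kA hA; rewrite /multiplier;
  under eq_fun do rewrite -mulrDr.
Qed.

Lemma multiplierZ b r k : multiplier b k -> multiplier b (fun x => r * k x).
Proof.
by move=> kA; have := approximableZ ha r kA; rewrite /multiplier;
  under eq_fun do rewrite mulrCA.
Qed.

Lemma multiplier1 b : multiplier b (fun=> 1).
Proof.
rewrite /multiplier; under eq_fun do rewrite mulr1.
exact/approximable_span/gauss_span_bgauss.
Qed.

Lemma multiplier0 b : multiplier b (fun=> 0).
Proof. by have := multiplierZ 0 (multiplier1 b); under eq_fun do rewrite mul0r. Qed.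

Lemma multiplier_sum b (T : Type) (l : seq T) (k : T -> R -> R) :
  (forall i, multiplier b (k i)) -> multiplier b (fun x => \sum_(i <- l) k i x).
Proof.
move=> kA; elim: l => [|i l IH].
  by under eq_fun do rewrite big_nil; exact: multiplier0.
by under eq_fun do rewrite big_cons; exact: multiplierD.
Qed.

Lemma multiplier_ray b r : multiplier b \1_(`]r, +oo[%classic).
Proof.
apply: (@multiplier_lim b (ray_approx r) _ 1).
- by move=> n; exact: approximable_bgauss_pow.
- exact: measurable_indic.
- exact: cvg_ray_approx.
- move=> n x x0; have /andP[h0 h1] := ray_approx_itv r n x0.
  by rewrite ger0_norm.
- by move=> x _; rewrite indicE normr_nat lern1 leq_b1.
Qed.

(** The sets whose indicator is a multiplier form a Dynkin system that contains the
open rays. *)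
Lemma multiplier_indic b (B : set R) : measurable B -> multiplier b \1_B.
Proof.
move=> mB.
suff h S : <<s @RGenOInfty.G R >> S -> multiplier b \1_S.
  have mGB : (@RGenOInfty.G R).-sigma.-measurable B.
    by rewrite -RGenOInfty.measurableE; exact: mB.
  exact: h mGB.
move: S; apply: (@dynkin_induction _ (measurableTypeR R) (@RGenOInfty.G R)
  (fun B => multiplier b \1_B)).
- exact: RGenOInfty.measurableE.
- move=> _ _ [x ->] [y ->]; exists (Num.max x y); apply/seteqP; split => z /=; rewrite !in_itv/= !andbT gt_max.
    by move=> [-> ->].
  by move=> /andP[-> ->].
- rewrite indicT; exact: multiplier1.
- by move=> _ [x ->]; exact: multiplier_ray.
- move=> S _ SA; have := multiplierD (multiplier1 b) (multiplierZ (-1) SA).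
  congr multiplier; apply/funext => x; rewrite indicC indicE.
  by case: (x \in S); rewrite ?mulr1 ?mulr0 ?subrr ?addr0 ?subr0.
- move=> F mF tF FA.
  have cF x : \sum_(0 <= i < n) (\1_(F i) x : R)%:E @[n --> \oo] -->
      (\1_(\bigcup_i F i) x : R)%:E.
    rewrite indic_bigcup//; apply: is_cvg_nneseries => n _ _.
    by rewrite lee_fin.
  have F1 n x : \sum_(0 <= i < n) \1_(F i) x <= 1 :> R.
    rewrite -lee_fin -sumEFin.
    apply: (@le_trans _ _ (\1_(\bigcup_i F i) x : R)%:E).
      by rewrite indic_bigcup//; apply: nneseries_lim_ge => i _ _; rewrite lee_fin.
    by rewrite lee_fin indicE lern1 leq_b1.
  apply: (@multiplier_lim b (fun n x => \sum_(0 <= i < n) \1_(F i) x) _ 1).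
  + by move=> n; apply: multiplier_sum => i; exact: FA.
  + by apply: measurable_indic; apply: bigcup_measurable => i _; exact: mF.
  + move=> x _; have /fine_cvgP[_] := cF x.
    by apply: cvg_trans; apply: near_eq_cvg; near=> n; rewrite /= sumEFin.
  + by move=> n x _; rewrite ger0_norm ?F1// sumr_ge0.
  + by move=> x _; rewrite indicE normr_nat lern1 leq_b1.
Unshelve. all: by end_near. Qed.

Import HBNNSimple.

Lemma multiplier_ge0 b k M : measurable_fun setT k ->
  (forall x, 0 <= k x <= M) -> multiplier b k.
Proof.
move=> mk kM.
have mEk : measurable_fun setT (EFin \o k) by apply/measurable_EFinP.
pose s := nnsfun_approx measurableT mEk.
have k0 x : (0 <= (EFin \o k) x)%E by rewrite lee_fin; case/andP: (kM x).
apply: (@multiplier_lim b (fun n => s n) k M) => //.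
- move=> n; rewrite (_ : (s n : R -> R) =
    fun x => \sum_(y <- finmap.enum_fset (fset_set (range (s n)))) y * \1_(s n @^-1` [set y]) x).
    apply: multiplier_sum => y; apply: multiplierZ; apply: multiplier_indic.
    exact: measurable_sfunP.
  by apply/funext => x; rewrite fimfunE fsbig_finite.
- move=> x _; have := @cvg_nnsfun_approx _ _ _ _ measurableT _ mEk (fun x _ => k0 x) x Logic.I.
  by move=> /fine_cvgP[].
- move=> n x _; rewrite ger0_norm//.
  have := @le_approx _ _ _ setT (EFin \o k) n x (fun x _ => k0 x) Logic.I.
  rewrite -nnsfun_approxE lee_fin => /le_trans; apply.
  by case/andP: (kM x).
- by move=> x _; have /andP[h1 h2] := kM x; rewrite ger0_norm.
Qed.

Lemma multiplier_bounded b k M : measurable_fun setT k ->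
  (forall x, `|k x| <= M) -> multiplier b k.
Proof.
move=> mk kM.
have h1 : multiplier b (fun x => k x + M).
  apply: (@multiplier_ge0 _ _ (M + M)); first exact: measurable_funD.
  by move=> x; have := kM x; rewrite ler_norml => /andP[? ?]; apply/andP; split; lra.
have := multiplierD h1 (multiplierZ (- M) (multiplier1 b)).
by congr multiplier; apply/funext => x; rewrite mulr1 addrK.
Qed.

(** Bounded and vanishing both near the origin and far from it, so that its even and
odd parts remain bounded functions of [v ^+ 2] after division by Gaussians. *)
Definition truncation g n v : R :=
  g v * \1_[set u | `|g u| <= n.+1%:R] v * \1_(`[n.+1%:R^-1, n.+1%:R]%classic) `|v|.

Lemma measurable_truncation g n : measurable_fun setT g ->
  measurable_fun setT (truncation g n).
Proof.
move=> mg; apply: measurable_funM.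
  apply: measurable_funM => //; apply: measurable_indic.
  rewrite (_ : [set u | _] = setT `&` (fun u => `|g u|) @^-1` `]-oo, n.+1%:R]%classic).
    by apply: (measurableT_comp _ mg) => //; exact: normr_measurable.
  by rewrite setTI; apply/seteqP; split => u /=; rewrite in_itv.
apply: (measurableT_comp (f := \1_(`[n.+1%:R^-1, n.+1%:R]%classic) : R -> R)).
  exact: measurable_indic.
exact: normr_measurable.
Qed.

Lemma truncation_le g n v : `|truncation g n v| <= `|g v|.
Proof.
rewrite /truncation !indicE !normrM !normr_nat -mulrA ler_piMr// -natrM lern1.
by case: (_ \in _); case: (_ \in _).
Qed.

Lemma truncation_eq0 g n v : ~~ (n.+1%:R^-1 <= `|v| <= n.+1%:R) ->
  truncation g n v = 0.
Proof.
move=> h; rewrite /truncation [X in _ * X]indicE (_ : (_ \in _) = false) ?mulr0//.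
by apply/negbTE; rewrite notin_setE/= in_itv/=; exact/negP.
Qed.

Lemma truncation_bound g n v : `|truncation g n v| <= n.+1%:R.
Proof.
rewrite /truncation; set A := [set u | _].
have [vA|vA] := boolP (v \in A); last first.
  by rewrite [X in _ * X * _]indicE (negbTE vA) mulr0 mul0r normr0.
apply: le_trans (truncation_le g n v) _.
by move: vA; rewrite inE.
Qed.

Lemma cvg_truncation g v : v != 0 -> truncation g n v @[n --> \oo] --> g v.
Proof.
rewrite -normr_gt0 => v0; apply: cvg_near_cst.
have [m /andP[m1 m2]] := invSn_le_le_Sn v0.
exists (maxn m (Num.trunc `|g v|)) => // n /=; rewrite geq_max => /andP[mn tn].
rewrite /truncation !indicE mem_set/=; last first.
  by apply: le_trans (ltW (truncnS_gt _)) _; rewrite ler_nat ltnS.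
rewrite mem_set ?mulr1//= in_itv/=; apply/andP; split.
  by apply: le_trans m1; exact: invSn_homo.
by apply: le_trans m2 _; rewrite ler_nat.
Qed.

(** The even part of [g], and its odd part divided by [v], are functions of [v ^+ 2]. *)
Lemma bgauss_parts g v : v != 0 ->
  bgauss false 1 v * (expR (v ^+ 2) *
    ((g (Num.sqrt (v ^+ 2)) + g (- Num.sqrt (v ^+ 2))) / 2)) +
  bgauss true 1 v * (expR (v ^+ 2) *
    ((g (Num.sqrt (v ^+ 2)) - g (- Num.sqrt (v ^+ 2))) / 2 *
     (v ^+ 2) `^ (- 2^-1))) = g v.
Proof.
move=> v0; rewrite powRN powR12_sqrt ?sqr_ge0// sqrtr_sqr.
have eE x : expR (- 1 * v ^+ 2) * (expR (v ^+ 2) * x) = x.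
  by rewrite mulrA -expRD mulN1r addNr expR0 mul1r.
rewrite /bgauss expr0 expr1 mul1r -[v * _ * _]mulrA !eE.
have [vp|vn] := ltrP 0 v.
  by rewrite gtr0_norm//; field.
by rewrite ler0_norm// opprK; field.
Qed.

Lemma approximable_truncation g n : measurable_fun setT g ->
  approximable a (truncation g n).
Proof.
move=> mg; set m : R := n.+1%:R; have m0 : 0 < m by rewrite /m.
set h := truncation g n.
have mh : measurable_fun setT h by exact: measurable_truncation.
(* Even part, and odd part over [v], of [h], in terms of [y = v ^+ 2]; the
   factor [expR y] removes the Gaussian. *)
pose k0 y := expR y * ((h (Num.sqrt y) + h (- Num.sqrt y)) / 2).
pose k1 y := expR y * ((h (Num.sqrt y) - h (- Num.sqrt y)) / 2 * y `^ (- 2^-1)).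
have msqrt : measurable_fun setT (@Num.sqrt R).
  by apply: continuous_measurable_fun; exact: sqrt_continuous.
have mhs : measurable_fun setT (fun y => h (Num.sqrt y)) by exact: measurableT_comp.
have mhNs : measurable_fun setT (fun y => h (- Num.sqrt y)).
  by apply: measurableT_comp mh _; exact: measurableT_comp.
have h0 y : ~~ (m^-1 <= Num.sqrt y <= m) -> h (Num.sqrt y) = 0 /\ h (- Num.sqrt y) = 0.
  by move=> hy; split; apply: truncation_eq0; rewrite ?normrN ger0_norm ?sqrtr_ge0.
have hm y : `|h y| <= m by exact: truncation_bound.
have ey y : Num.sqrt y <= m -> expR y <= expR (m ^+ 2).
  move=> ym; rewrite ler_expR; have [y0|/ltW y0] := leP 0 y.
    by rewrite -(sqr_sqrtr y0) lerXn2r ?nnegrE ?sqrtr_ge0// ltW.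
  by rewrite (le_trans y0) ?sqr_ge0.
have A0 : multiplier false k0.
  apply: (@multiplier_bounded _ _ (expR (m ^+ 2) * m)).
    apply: measurable_funM; first exact: measurable_expR.
    by apply: measurable_funM => //; exact: measurable_funD.
  move=> y; rewrite /k0.
  have [/andP[_ ym]|/h0[-> ->]] := boolP (m^-1 <= Num.sqrt y <= m); last first.
    by rewrite addr0 mul0r mulr0 normr0 mulr_ge0 ?expR_ge0// ltW.
  rewrite normrM (ger0_norm (expR_ge0 _)) ler_pM ?expR_ge0 ?ey//.
  rewrite normrM (ger0_norm (_ : 0 <= 2^-1))//.
  have := ler_normD (h (Num.sqrt y)) (h (- Num.sqrt y)).
  by have := hm (Num.sqrt y); have := hm (- Num.sqrt y); lra.
have A1 : multiplier true k1.
  apply: (@multiplier_bounded _ _ (expR (m ^+ 2) * (m * m))).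
    apply: measurable_funM; first exact: measurable_expR.
    apply: measurable_funM; last exact: measurable_powR.
    by apply: measurable_funM => //; exact: measurable_funB.
  move=> y; rewrite /k1.
  have [/andP[my ym]|/h0[-> ->]] := boolP (m^-1 <= Num.sqrt y <= m); last first.
    by rewrite subr0 !mul0r mulr0 normr0 !mulr_ge0 ?expR_ge0// ltW.
  have sy0 : 0 < Num.sqrt y by apply: lt_le_trans my; rewrite invr_gt0.
  rewrite normrM (ger0_norm (expR_ge0 _)) ler_pM ?expR_ge0 ?ey//.
  rewrite normrM ler_pM//.
    rewrite normrM (ger0_norm (_ : 0 <= 2^-1))//.
    have := ler_normB (h (Num.sqrt y)) (h (- Num.sqrt y)).
    by have := hm (Num.sqrt y); have := hm (- Num.sqrt y); lra.
  have y0 : 0 <= y by rewrite ltW// -sqrtr_gt0.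
  rewrite powRN powR12_sqrt// normfV gtr0_norm// -[leRHS]invrK.
  by rewrite lef_pV2 ?posrE ?invr_gt0.
have := approximableD ha A0 A1.
rewrite (_ : (fun v => _) = h)//; apply/funext => v.
have [->|v0] := eqVneq v 0; last exact: bgauss_parts.
rewrite /k0 /k1 expr0n sqrtr0 oppr0 /h.
have -> : truncation g n 0 = 0.
  by apply: truncation_eq0; rewrite normr0 invr_le0 leNgt ltr0n.
by rewrite !(addr0, subr0, mul0r, mulr0).
Qed.

Theorem L1L2_approximable g : L1L2 a g -> approximable a g.
Proof.
move=> gL; have mg := gL.1.
apply: (@approximable_lim _ _ ha (truncation g) _ (fun v => `|g v|)) => //.
- by move=> n; exact: approximable_truncation.
- by move=> v; exact: cvg_truncation.
- by apply: L1L2_dominated gL => [|v]; [exact: measurableT_comp|rewrite normr_id].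
- by move=> n v; exact: truncation_le.
Qed.

End gaussian_density.

(** * Plancherel formula for the real transform *)

Section plancherel.
Context {R : realType}.
Implicit Types (f g h phi : R -> R).
Set Implicit Arguments.
Unset Strict Implicit.
Local Notation L := (@lebesgue_measure R).

Lemma limn_einf_le (u : (\bar R)^nat) (l : \bar R) :
  (forall n, (u n <= l)%E) -> (limn_einf u <= l)%E.
Proof.
move=> ul; rewrite limn_einf_lim; apply: lime_le.
  by apply: ereal_nondecreasing_is_cvgn; exact: nondecreasing_einfs.
apply: nearW => n; apply: le_trans (ul n).
by apply: ereal_inf_lbound; exists n => //=.
Qed.

Context (a : R) (ha : 1 / 2 <= a).
Local Notation wint := (weighted_integrable a).
Local Notation I := (weighted_integral a).

Lemma fatou_sqr (F_ : (R -> R)^nat) (F : R -> R) (B : R) :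
  (forall n, measurable_fun setT (F_ n)) ->
  (forall v, F_ n v @[n --> \oo] --> F v) ->
  (forall n, wint (fun v => F_ n v ^+ 2)) ->
  (forall n, I (fun v => F_ n v ^+ 2) <= B) ->
  [/\ measurable_fun setT F, wint (fun v => F v ^+ 2) & I (fun v => F v ^+ 2) <= B].
Proof.
move=> mF_ cF iF_ FB.
have mF : measurable_fun setT F.
  by apply: (measurable_fun_cvg mF_) => v _; exact: cF.
have mFw (G : R -> R) : measurable_fun setT G ->
    measurable_fun setT (fun v : R => (G v ^+ 2 * weight a v)%:E).
  move=> mG; apply/measurable_EFinP; apply: measurable_funM.
    exact: measurable_funX.
  exact: measurable_weight.
have F0 (G : R -> R) v : (0 <= (G v ^+ 2 * weight a v)%:E)%E.
  by rewrite lee_fin mulr_ge0 ?sqr_ge0 ?weight_ge0.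
have intB : (\int[L]_v (F v ^+ 2 * weight a v)%:E <= B%:E)%E.
  have := @fatou _ _ R L setT measurableT (fun n v => (F_ n v ^+ 2 * weight a v)%:E)
    (fun n => mFw _ (mF_ n)) (fun n v _ => F0 (F_ n) v).
  have -> : (fun v => limn_einf (fun n => (F_ n v ^+ 2 * weight a v)%:E)) =
            (fun v => (F v ^+ 2 * weight a v)%:E).
    apply/funext => v; apply: (cvg_limn_einf_sup _).1.
    apply: cvg_EFin; first by apply: nearW => n.
    apply: cvgM; last exact: cvg_cst.
    exact: (cvgM (cF v) (cF v)).
  move=> /le_trans; apply; apply: limn_einf_le => n.
  by rewrite integral_RintegralE ?lee_fin; [exact: FB|exact: iF_].
have iF : wint (fun v => F v ^+ 2).
  apply/integrableP; split; first exact: mFw.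
  apply: le_lt_trans (ltry B); apply: le_trans intB.
  rewrite le_eqVlt; apply/orP; left; apply/eqP/eq_integral => v _.
  by rewrite gee0_abs ?F0.
split=> //; rewrite -lee_fin -integral_RintegralE//.
Qed.

(** Young's inequality; for small [d] the factor of the first term is close to 1. *)
Lemma weighted_integral_sqrD_le f g (d : R) : 0 < d -> L1L2 a f -> L1L2 a g ->
  I (fun v => (f v + g v) ^+ 2) <=
  (1 + d) * I (fun v => f v ^+ 2) + (1 + d^-1) * I (fun v => g v ^+ 2).
Proof.
move=> d0 fL gL; have f2 := L1L2_integrable_sqr fL; have g2 := L1L2_integrable_sqr gL.
rewrite -!weighted_integralZ// -weighted_integralD; [|exact: weighted_integrableZ..].
apply: le_weighted_integral.
- exact: L1L2_integrable_sqr (L1L2D fL gL).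
- by apply: weighted_integrableD; exact: weighted_integrableZ.
- move=> v; rewrite -subr_ge0.
  have -> : (1 + d) * f v ^+ 2 + (1 + d^-1) * g v ^+ 2 - (f v + g v) ^+ 2 =
    d * (f v - d^-1 * g v) ^+ 2 by field; rewrite gt_eqF.
  by rewrite mulr_ge0 ?sqr_ge0// ltW.
Qed.

Lemma weighted_integral_parallelogram f g : measurable_fun setT f -> measurable_fun setT g ->
  wint (fun v => f v ^+ 2) -> wint (fun v => g v ^+ 2) ->
  I (fun v => (f v + g v) ^+ 2) + I (fun v => (f v - g v) ^+ 2) =
  2 * I (fun v => f v ^+ 2) + 2 * I (fun v => g v ^+ 2).
Proof.
move=> mf mg f2 g2; have fg := weighted_integrableM mf mg f2 g2.
have E (c : R) : I (fun v => (f v + c * g v) ^+ 2) =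
    I (fun v => f v ^+ 2) + c ^+ 2 * I (fun v => g v ^+ 2) + 2 * c * I (fun v => f v * g v).
  rewrite -!weighted_integralZ// -weighted_integralD; [|exact: f2|exact: weighted_integrableZ].
  rewrite -weighted_integralD; [|by apply: weighted_integrableD => //; exact: weighted_integrableZ|exact: weighted_integrableZ].
  by apply: eq_weighted_integral => v; ring.
have := E 1; have := E (-1).
under eq_weighted_integral do rewrite mulN1r.
under [in X in _ -> X -> _]eq_weighted_integral do rewrite mul1r.
by move=> -> ->; ring.
Qed.

Context (beta : R) (beta0 : beta != 0).
Local Notation H := (hartley a beta).

Lemma hartleyB f g w : L1L2 a f -> L1L2 a g ->
  H (fun v => f v - g v) w = H f w - H g w.
Proof.
move=> fL gL; rewrite -[- H g w]mulN1r -(hartleyZ ha)// -(hartleyD ha)//; last exact: L1L2Z.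
by congr (hartley _ _ _ _); apply/funext => v; rewrite mulN1r.
Qed.

(** Closeness in L1 gives the pointwise convergence of the transforms. *)
Lemma span_approximation g (d : R) : L1L2 a g -> 0 < d ->
  exists phi_ : (R -> R)^nat,
  [/\ forall n, gauss_span (phi_ n),
      forall n, I (mixed_norm (fun v => g v - phi_ n v)) <= d
    & forall w, H (phi_ n) w @[n --> \oo] --> H g w].
Proof.
move=> gL d0.
have h n : exists phi, gauss_span phi /\
    I (mixed_norm (fun v => g v - phi v)) < Num.min d n.+1%:R^-1.
  have e0 : 0 < Num.min d n.+1%:R^-1 by rewrite lt_min d0 invr_gt0 ltr0n.
  by have [phi pS pe] := (L1L2_approximable ha gL).2 _ e0; exists phi.
have [phi_ pP] := choice h; exists phi_; split.
- by move=> n; exact: (pP n).1.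
- by move=> n; have := (pP n).2; rewrite lt_min => /andP[/ltW].
- move=> w; apply/cvgrPdist_le => /= e e0.
  set C := hartley_const a beta * (2 / Gamma a).
  have C0 : 0 <= C by rewrite mulr_ge0 ?divr_ge0 ?Gamma_ge0// powR_ge0.
  have ch : C * n.+1%:R^-1 @[n --> \oo] --> 0.
    by rewrite -(mulr0 C); apply: cvgM; [exact: cvg_cst|exact: cvg_harmonic].
  near=> n.
  have pL := gauss_span_L1L2 ha (pP n).1.
  rewrite -hartleyB//; apply: le_trans (hartley_le ha beta w (L1L2B gL pL)) _.
  apply: (@le_trans _ _ (C * n.+1%:R^-1)).
    by rewrite ler_wpM2l//; have := (pP n).2; rewrite lt_min => /andP[_ /ltW].
  near: n; have := cvgr_le _ ch; exact.
Unshelve. all: by end_near. Qed.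

(** Along the approximating sequence the transforms converge pointwise and the
isometry bounds their L2 norms, so Fatou's lemma applies. *)
Lemma hartley_contraction g : L1L2 a g ->
  [/\ measurable_fun setT (H g), wint (fun w => H g w ^+ 2) &
      I (fun w => H g w ^+ 2) <= I (fun v => g v ^+ 2)].
Proof.
move=> gL; set G := I (fun v => g v ^+ 2).
have G0 : 0 <= G by apply: weighted_integral_ge0 => v; exact: sqr_ge0.
(* The loss [d] pays for comparing the norms of [phi_ n] and of [g]. *)
have key (d : R) : 0 < d -> [/\ measurable_fun setT (H g), wint (fun w => H g w ^+ 2) &
      I (fun w => H g w ^+ 2) <= (1 + d) * G + d].
  move=> d0; have d1 : 0 < 1 + d^-1 by rewrite addr_gt0// invr_gt0.
  have e0 : 0 < d / (1 + d^-1) by exact: divr_gt0.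
  have [phi_ [pS pe pH]] := span_approximation gL e0.
  apply: (@fatou_sqr (fun n => H (phi_ n))) => //.
  - by move=> n; exact: (gauss_span_L1L2_hartley ha beta0 (pS n)).1.
  - by move=> n; apply: L1L2_integrable_sqr; exact: gauss_span_L1L2_hartley.
  - move=> n; rewrite hartley_span_isometry//.
    have pL := gauss_span_L1L2 ha (pS n); have gpL := L1L2B gL pL.
    have -> : I (fun v => phi_ n v ^+ 2) = I (fun v => (g v + -1 * (g v - phi_ n v)) ^+ 2).
      by apply: eq_weighted_integral => v; congr (_ ^+ 2); ring.
    apply: le_trans (weighted_integral_sqrD_le d0 gL (L1L2Z (-1) gpL)) _.
    rewrite lerD2l mulrC -ler_pdivlMr//; apply: le_trans (pe n).
    apply: le_weighted_integral; [exact: L1L2_integrable_sqr (L1L2Z (-1) gpL)|exact: gpL.2|].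
    by move=> v; rewrite /mixed_norm mulN1r sqrrN lerDr.
have [mH iH _] := key 1 ltr01; split=> //.
apply/ler_addgt0Pr => e e0.
have d0 : 0 < e / (1 + G) by rewrite divr_gt0// ltr_pwDl.
have [_ _ /le_trans] := key _ d0; apply.
have -> : (1 + e / (1 + G)) * G + e / (1 + G) = G + e * (G + 1) / (1 + G) by ring.
by rewrite [G + 1]addrC mulfK// gt_eqF// ltr_pwDl.
Qed.

Lemma parallelogram_squeeze (G X S P K Y T e : R) :
  G + X = 2 * S + 2 * P -> K + Y = 2 * T + 2 * P ->
  Y <= X -> S <= e / 2 -> 0 <= T -> G <= K + e.
Proof. by move=> *; lra. Qed.

(** The defect [I (g ^+ 2) - I (H g ^+ 2)] is a quadratic form, nonnegative by contraction
and zero on the span. By the parallelogram law its value at [g] is at most twice its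
value at [g - p], for every [p] in the span. *)
Theorem hartley_plancherel g : L1L2 a g ->
  [/\ measurable_fun setT (H g), wint (fun w => H g w ^+ 2) &
      I (fun w => H g w ^+ 2) = I (fun v => g v ^+ 2)].
Proof.
move=> gL; have [mH iH Hle] := hartley_contraction gL; split=> //.
apply/eqP; rewrite eq_le Hle/=; apply/ler_addgt0Pr => e e0.
have e2 : 0 < e / 2 by rewrite divr_gt0.
have [phi_ [pS pe _]] := span_approximation gL e2.
set p := phi_ 0%N; have pL := gauss_span_L1L2 ha (pS 0%N); rewrite -/p in pL.
have pI : I (fun w => H p w ^+ 2) = I (fun v => p v ^+ 2).
  exact: (hartley_span_isometry ha beta0 (pS 0%N)).
have dL := L1L2B gL pL; have [mHd iHd Hd] := hartley_contraction dL.
have [mHp iHp _] := hartley_contraction pL.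
have [_ _ Hdd] := hartley_contraction (L1L2B dL pL).
have P1 := weighted_integral_parallelogram dL.1 pL.1 (L1L2_integrable_sqr dL) (L1L2_integrable_sqr pL).
have P2 := weighted_integral_parallelogram mHd mHp iHd iHp.
have g1 : I (fun v => (g v - p v + p v) ^+ 2) = I (fun v => g v ^+ 2).
  by apply: eq_weighted_integral => v; rewrite subrK.
have g2 : I (fun w => (H (fun v => g v - p v)%R w + H p w) ^+ 2) = I (fun w => H g w ^+ 2).
  by apply: eq_weighted_integral => w; rewrite hartleyB// subrK.
have g3 : I (fun w => (H (fun v => g v - p v)%R w - H p w) ^+ 2) =
    I (fun w => H (fun v => g v - p v - p v) w ^+ 2).
  by apply: eq_weighted_integral => w; rewrite -hartleyB.
have small : I (fun v => (g v - p v) ^+ 2) <= e / 2.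
  apply: le_trans (pe 0%N); apply: le_weighted_integral; [exact: L1L2_integrable_sqr|exact: dL.2|].
  by move=> v; rewrite /mixed_norm lerDr.
have Hd0 : 0 <= I (fun w => H (fun v => g v - p v) w ^+ 2).
  by apply: weighted_integral_ge0 => w; exact: sqr_ge0.
rewrite g1 in P1; rewrite g2 g3 pI in P2.
exact: parallelogram_squeeze P1 P2 Hdd small Hd0.
Qed.

End plancherel.

(** * Complex-valued functions *)

Section complex_arithmetic.
Context {R : realType}.
Implicit Types (z w : R[i]) (r s x y : R).
Set Implicit Arguments.
Unset Strict Implicit.
Local Open Scope complex_scope.
Local Notation normc := Normc.normc.
Local Notation Re := complex.Re.
Local Notation Im := complex.Im.

Lemma normc_sqr z : normc z ^+ 2 = Re z ^+ 2 + Im z ^+ 2.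
Proof. by case: z => x y /=; rewrite sqr_sqrtr// addr_ge0 ?sqr_ge0. Qed.

Lemma ReM z w : Re (z * w) = Re z * Re w - Im z * Im w.
Proof. by case: z => x y; case: w. Qed.

Lemma ImM z w : Im (z * w) = Re z * Im w + Im z * Re w.
Proof. by case: z => x y; case: w. Qed.

Lemma ReD z w : Re (z + w) = Re z + Re w.
Proof. by case: z => x y; case: w. Qed.

Lemma ImD z w : Im (z + w) = Im z + Im w.
Proof. by case: z => x y; case: w. Qed.

Lemma normc_ge0 z : 0 <= normc z.
Proof. by case: z => x y; exact: sqrtr_ge0. Qed.

Lemma Re_le_normc z : `|Re z| <= normc z.
Proof. by case: z => x y /=; rewrite -sqrtr_sqr ler_wsqrtr// lerDl sqr_ge0. Qed.

Lemma Im_le_normc z : `|Im z| <= normc z.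
Proof. by case: z => x y /=; rewrite -sqrtr_sqr ler_wsqrtr// lerDr sqr_ge0. Qed.

Lemma cexp_phase r : cexp (- 'i * r%:C) = cos r +i* - sin r.
Proof.
have -> : - 'i * r%:C = 0 +i* - r.
  by apply/eqP; rewrite eq_complex ReM ImM /=; apply/andP; split; apply/eqP; ring.
rewrite /cexp /= expR0 cosN sinN.
by apply/eqP; rewrite eq_complex ReM ImM /=; apply/andP; split; apply/eqP; ring.
Qed.

Lemma normc_cexp z : normc (cexp z) = expR (Re z).
Proof.
rewrite /cexp Normc.normcM /= cos2Dsin2 sqrtr1 mulr1 expr0n addr0 sqrtr_sqr.
by rewrite ger0_norm ?expR_ge0.
Qed.

Lemma normc_cpow z x : z != 0 -> normc (cpow z x%:C) = normc z `^ x.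
Proof.
move=> z0; rewrite /cpow (negbTE z0) normc_cexp ReM /= mul0r subr0 /powR.
by case: eqP => // /Normc.eq0_normc /eqP; rewrite (negbTE z0).
Qed.

Lemma normc_imaginary x : normc ('i * x%:C) = `|x|.
Proof.
by rewrite Normc.normcM /= expr0n expr1n add0r addr0 sqrtr1 mul1r sqrtr_sqr.
Qed.

Lemma cmeasurableM (f g : R -> R[i]) : cmeasurable f -> cmeasurable g ->
  cmeasurable (fun v => f v * g v).
Proof.
move=> [f1 f2] [g1 g2]; split.
  under eq_fun do rewrite ReM.
  by apply: measurable_funB; exact: measurable_funM.
under eq_fun do rewrite ImM.
by apply: measurable_funD; exact: measurable_funM.
Qed.

Lemma cmeasurable_phase (p : R -> R) : measurable_fun setT p ->
  cmeasurable (fun v => cexp (- 'i * (p v)%:C)).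
Proof.
move=> mp; rewrite /cmeasurable.
under eq_fun do rewrite cexp_phase.
under [X in _ /\ measurable_fun _ X]eq_fun do rewrite cexp_phase.
split => /=.
  by apply: measurableT_comp mp; apply: continuous_measurable_fun; exact: continuous_cos.
apply: measurableT_comp => //; apply: measurableT_comp mp.
by apply: continuous_measurable_fun; exact: continuous_sin.
Qed.

Lemma cmeasurable_normc (f : R -> R[i]) : cmeasurable f ->
  measurable_fun setT (fun v => normc (f v)).
Proof.
move=> [f1 f2].
rewrite (_ : (fun v => _) = fun v => Num.sqrt (Re (f v) ^+ 2 + Im (f v) ^+ 2)).
  apply: (measurableT_comp (f := @Num.sqrt R)).
    by apply: continuous_measurable_fun; exact: sqrt_continuous.
  by apply: measurable_funD; exact: measurable_funX.
by apply/funext => v; case: (f v).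
Qed.

End complex_arithmetic.

Section Lmu.
Context {R : realType}.
Implicit Types (f g : R -> R[i]) (mu p : R).
Set Implicit Arguments.
Unset Strict Implicit.
Local Open Scope complex_scope.
Local Notation normc := Normc.normc.
Local Notation Re := complex.Re.
Local Notation Im := complex.Im.
Local Notation L := (@lebesgue_measure R).

Lemma weight_muE mu v : `|v| `^ (2 * mu + 1) = weight (mu + 1) v.
Proof. by rewrite /weight; congr (_ `^ _); ring. Qed.

(** An infinite integral would have an infinite root. *)
Lemma in_Lmu_weighted_integrable mu p f : 0 < p -> in_Lmu mu p f ->
  weighted_integrable (mu + 1) (fun v => normc (f v) `^ p).
Proof.
move=> p0 [mf fp]; apply/integrableP; split.
  apply/measurable_EFinP; apply: measurable_funM; last exact: measurable_weight.
  apply: (measurableT_comp (measurable_powR _)); exact: cmeasurable_normc.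
move: fp; rewrite /Lmu_norm.
rewrite [X in (X `^ _)%E](_ : _ =
    \int[L]_v `|(normc (f v) `^ p * weight (mu + 1) v)%:E|)%E; last first.
  apply: eq_integral => v _; rewrite weight_muE gee0_abs// lee_fin.
  by rewrite mulr_ge0 ?powR_ge0.
rewrite /comp; case: (\int[L]_v _)%E => [r| |]//; rewrite ?ltry//.
by rewrite poweRyr ?invr_eq0 ?gt_eqF.
Qed.

Lemma in_Lmu_L1L2 mu f (g : R -> R) : in_Lmu mu 1 f -> in_Lmu mu 2 f ->
  measurable_fun setT g -> (forall v, `|g v| <= normc (f v)) -> L1L2 (mu + 1) g.
Proof.
move=> f1 f2 mg gf; apply: L1L2_intro => //.
- apply: weighted_integrable_dominated (in_Lmu_weighted_integrable ltr01 f1); first exact: measurableT_comp.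
  by move=> v; rewrite normr_id powRr1 ?normc_ge0 ?gf.
- apply: weighted_integrable_dominated (in_Lmu_weighted_integrable (@ltr0Sn R 1) f2); first exact: measurable_funX.
  by move=> v; rewrite powR_mulrn ?normc_ge0// normrX; apply: lerXn2r;
    rewrite ?nnegrE ?normc_ge0 ?gf.
Qed.

Lemma Lmu_norm2E mu f :
  weighted_integrable (mu + 1) (fun v => Re (f v) ^+ 2 + Im (f v) ^+ 2) ->
  Lmu_norm mu 2 f = ((weighted_integral (mu + 1)
    (fun v => Re (f v) ^+ 2 + Im (f v) ^+ 2))%:E `^ 2^-1)%E.
Proof.
move=> fi; rewrite /Lmu_norm; congr (_ `^ _)%E.
rewrite /weighted_integral -(integral_RintegralE fi); apply: eq_integral => v _.
by rewrite weight_muE (powR_mulrn 2) ?normc_ge0// normc_sqr.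
Qed.

End Lmu.

(** * The Dunkl transform *)

Section dunkl_kernel.
Context {R : realType}.
Implicit Types (mu w v z : R).
Set Implicit Arguments.
Unset Strict Implicit.
Local Open Scope complex_scope.

Lemma bessel_jE mu z :
  bessel_j mu z = Gamma (mu + 1) * bessel_series (mu + 1) ((z / 2) ^+ 2).
Proof.
rewrite /bessel_j; congr (_ * _).
transitivity (limn (pseries (bessel_coef (mu + 1)) ((z / 2) ^+ 2))); last by [].
congr (limn _); apply/funext => n; apply: eq_bigr => i _.
by rewrite exprM mulrAC -addrA.
Qed.

Lemma dunkl_kernelE mu w v : - (1 / 2) <= mu ->
  dunkl_kernel mu w v =
  (Gamma (mu + 1) * even_kernel (mu + 1) (w * v)) +i*
  (Gamma (mu + 1) * odd_kernel (mu + 1) (w * v)).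
Proof.
move=> hmu; have m0 : 0 < mu + 1 by lra.
rewrite /dunkl_kernel !bessel_jE (GammaS m0).
rewrite /even_kernel /odd_kernel; set z := w * v.
set B := bessel_series (mu + 1) _; set B1 := bessel_series (mu + 1 + 1) _.
set G := Gamma (mu + 1).
have -> : ((2 * (mu + 1))%:C)^-1 = ((2 * (mu + 1))^-1)%:C :> R[i].
  by rewrite -fmorphV.
apply/eqP; rewrite eq_complex !(ReD, ImD, ReM, ImM) /=; apply/andP; split; apply/eqP.
  ring.
by field; rewrite gt_eqF.
Qed.

End dunkl_kernel.

Section dunkl_transform.
Context {R : realType}.
Set Implicit Arguments.
Unset Strict Implicit.
Local Open Scope complex_scope.
Local Notation normc := Normc.normc.
Local Notation Re := complex.Re.
Local Notation Im := complex.Im.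

Context (al : R) (hal : 1 / 2 <= al) (beta : R) (beta0 : beta != 0).
Local Notation I := (weighted_integral al).
Local Notation wint := (weighted_integrable al).
Local Notation H := (hartley al beta).
Local Notation K := (hartley_const al beta).

Definition even_transform (g : R -> R) w :=
  I (fun v => even_kernel al (beta * w * v) * g v).
Definition odd_transform (g : R -> R) w :=
  I (fun v => odd_kernel al (beta * w * v) * g v).
Local Notation Ct := even_transform.
Local Notation St := odd_transform.

Lemma weighted_integrable_even_kernel (g : R -> R) w : L1L2 al g ->
  wint (fun v => even_kernel al (beta * w * v) * g v).
Proof.
move=> gL; apply: (@weighted_integrable_kernelM _ _ _ _ (Gamma al)^-1).
- exact: measurable_scale (measurable_even_kernel hal).
- by move=> z; exact: even_kernel_le.
- exact: gL.1.
- exact: L1L2_integrable_norm.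
Qed.

Lemma weighted_integrable_odd_kernel (g : R -> R) w : L1L2 al g ->
  wint (fun v => odd_kernel al (beta * w * v) * g v).
Proof.
move=> gL; apply: (@weighted_integrable_kernelM _ _ _ _ (Gamma al)^-1).
- exact: measurable_scale (measurable_odd_kernel hal).
- by move=> z; exact: odd_kernel_le.
- exact: gL.1.
- exact: L1L2_integrable_norm.
Qed.

Lemma hartley_split (g : R -> R) w : L1L2 al g -> H g w = K * (Ct g w + St g w).
Proof.
move=> gL; rewrite /hartley -weighted_integralD; [|exact: weighted_integrable_even_kernel|exact: weighted_integrable_odd_kernel].
by congr (_ * _); apply: eq_weighted_integral => v; rewrite -mulrDl.
Qed.

Lemma even_transformN (g : R -> R) w : Ct g (- w) = Ct g w.
Proof. by apply: eq_weighted_integral => v; rewrite mulrN mulNr even_kernelN. Qed.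

Lemma odd_transformN (g : R -> R) w : L1L2 al g -> St g (- w) = - St g w.
Proof.
move=> gL; rewrite /odd_transform -[RHS]mulN1r -weighted_integralZ; last exact: weighted_integrable_odd_kernel.
by apply: eq_weighted_integral => v; rewrite mulrN mulNr odd_kernelN; ring.
Qed.

Lemma hartley_const_gt0 : 0 < K.
Proof. by rewrite powR_gt0// divr_gt0// normr_gt0. Qed.

Lemma measurable_reflect (g : R -> R) : measurable_fun setT g ->
  measurable_fun setT (fun v : R => g (- v)).
Proof. by move=> mg; apply: measurableT_comp mg _; exact: oppr_measurable. Qed.

Lemma measurable_even_transform (g : R -> R) : L1L2 al g ->
  measurable_fun setT (Ct g).
Proof.
move=> gL; have [mH _ _] := hartley_plancherel hal beta0 gL.
rewrite (_ : Ct g = fun w => (2 * K)^-1 * (H g w + H g (- w))).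
  apply: measurable_funM; first exact: measurable_cst.
  exact: measurable_funD mH (measurable_reflect mH).
apply/funext => w; rewrite !hartley_split// even_transformN odd_transformN//.
by field; rewrite gt_eqF ?hartley_const_gt0.
Qed.

Lemma measurable_odd_transform (g : R -> R) : L1L2 al g ->
  measurable_fun setT (St g).
Proof.
move=> gL; have [mH _ _] := hartley_plancherel hal beta0 gL.
rewrite (_ : St g = fun w => (2 * K)^-1 * (H g w - H g (- w))).
  apply: measurable_funM; first exact: measurable_cst.
  exact: measurable_funB mH (measurable_reflect mH).
apply/funext => w; rewrite !hartley_split// even_transformN odd_transformN//.
by field; rewrite gt_eqF ?hartley_const_gt0.
Qed.

Lemma weighted_integral_reflect (g : R -> R) : measurable_fun setT g -> I (fun v => g (- v)) = I g.
Proof.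
move=> mg; rewrite -[RHS](@Rintegral_reflect _ (fun v => g v * weight al v)).
  by apply: eq_Rintegral => v _; rewrite weightN.
by apply: measurable_funM => //; exact: measurable_weight.
Qed.

Lemma weighted_integrable_reflect (g : R -> R) : measurable_fun setT g -> (forall v, 0 <= g v) ->
  wint g -> wint (fun v => g (- v)).
Proof.
move=> mg g0 gi; have mgw : measurable_fun setT (fun v => (g v * weight al v)%:E).
  apply/measurable_EFinP; apply: measurable_funM => //; exact: measurable_weight.
apply: (@ge0_integrable _ _ (I g)).
- apply: measurable_funM; [exact: measurable_reflect|exact: measurable_weight].
- by move=> v; rewrite mulr_ge0 ?weight_ge0.
- rewrite -(integral_RintegralE gi) -[RHS](ge0_integral_reflect mgw).
    by apply: eq_integral => v _; rewrite weightN.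
  by move=> v; rewrite lee_fin mulr_ge0 ?weight_ge0.
Qed.

Lemma half_eq (x y z : R) : (y + y) + (z + z) = x + x -> x = y + z.
Proof. by move=> h; lra. Qed.

(** Adding the values at [w] and [- w] cancels the products of even and odd transforms,
and leaves the same squares as for the real transforms of [f1] and [f2]. *)
Lemma complex_plancherel (f1 f2 : R -> R) : L1L2 al f1 -> L1L2 al f2 ->
  let T w := K ^+ 2 * ((Ct f1 w - St f2 w) ^+ 2 + (Ct f2 w + St f1 w) ^+ 2) in
  wint T /\ I T = I (fun v => f1 v ^+ 2 + f2 v ^+ 2).
Proof.
move=> L1 L2 T.
have [mH1 iH1 eH1] := hartley_plancherel hal beta0 L1.
have [mH2 iH2 eH2] := hartley_plancherel hal beta0 L2.
have mC1 := measurable_even_transform L1; have mC2 := measurable_even_transform L2.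
have mS1 := measurable_odd_transform L1; have mS2 := measurable_odd_transform L2.
have mT : measurable_fun setT T.
  apply: measurable_funM => //; apply: measurable_funD; apply: measurable_funX.
    exact: measurable_funB.
  exact: measurable_funD.
have T0 w : 0 <= T w by rewrite mulr_ge0 ?addr_ge0 ?sqr_ge0.
pose h1 w := H f1 w ^+ 2; pose h2 w := H f2 w ^+ 2.
have mh1 : measurable_fun setT h1 by exact: measurable_funX.
have mh2 : measurable_fun setT h2 by exact: measurable_funX.
have ih1N : wint (fun w => h1 (- w)).
  by apply: weighted_integrable_reflect => // w; exact: sqr_ge0.
have ih2N : wint (fun w => h2 (- w)).
  by apply: weighted_integrable_reflect => // w; exact: sqr_ge0.
(* The even transforms do not change and the odd ones change sign, so that the
   mixed products cancel on both sides. *)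
have TT w : T w + T (- w) = (h1 w + h1 (- w)) + (h2 w + h2 (- w)).
  rewrite /T /h1 /h2 !hartley_split// !even_transformN !odd_transformN//.
  ring.
have ih1 : wint h1 by exact: iH1.
have ih2 : wint h2 by exact: iH2.
have eh1 : I h1 = I (fun v => f1 v ^+ 2) by exact: eH1.
have eh2 : I h2 = I (fun v => f2 v ^+ 2) by exact: eH2.
clearbody T h1 h2.
have iS : wint (fun w => (h1 w + h1 (- w)) + (h2 w + h2 (- w))).
  by apply: weighted_integrableD; apply: weighted_integrableD.
have iT : wint T.
  apply: weighted_integrable_dominated iS => // w.
  by rewrite (ger0_norm (T0 w)) -(TT w) lerDl T0.
split=> //.
have iTN : wint (fun w => T (- w)) by exact: weighted_integrable_reflect.
have e1 : I (fun w => T w + T (- w)) = I T + I T.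
  by rewrite weighted_integralD// (weighted_integral_reflect mT).
have e2 : I (fun w => (h1 w + h1 (- w)) + (h2 w + h2 (- w))) =
    (I h1 + I h1) + (I h2 + I h2).
  rewrite weighted_integralD; [|exact: weighted_integrableD..].
  by rewrite weighted_integralD// (weighted_integral_reflect mh1) weighted_integralD// (weighted_integral_reflect mh2).
rewrite weighted_integralD; [|exact: L1L2_integrable_sqr..].
rewrite -eh1 -eh2; move: e1; rewrite (eq_weighted_integral al TT) e2.
exact: half_eq.
Qed.

End dunkl_transform.

(** * The quadratic-phase transform *)

Section quadratic_phase.
Context {R : realType}.
Set Implicit Arguments.
Unset Strict Implicit.
Local Open Scope complex_scope.
Local Notation normc := Normc.normc.
Local Notation Re := complex.Re.
Local Notation Im := complex.Im.
Local Notation L := (@lebesgue_measure R).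

Lemma cintegralZ (z : R[i]) (F : R -> R[i]) :
  L.-integrable setT (EFin \o (fun v => Re (F v))) ->
  L.-integrable setT (EFin \o (fun v => Im (F v))) ->
  cintegral (fun v => z * F v) = z * cintegral F.
Proof.
move=> FR FI; apply/eqP; rewrite eq_complex ReM ImM /cintegral /=.
apply/andP; split; apply/eqP.
  rewrite -!RintegralZl// -RintegralB//; try exact: integrable_EFinZ.
  by apply: eq_Rintegral => v _; rewrite ReM.
rewrite -!RintegralZl// -RintegralD//; try exact: integrable_EFinZ.
by apply: eq_Rintegral => v _; rewrite ImM.
Qed.

Lemma cexpD_phase (x y : R) :
  cexp (- 'i * (x + y)%:C) = cexp (- 'i * x%:C) * cexp (- 'i * y%:C).
Proof.
rewrite !cexp_phase cosD sinD; apply/eqP; rewrite eq_complex ReM ImM /=.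
by apply/andP; split; apply/eqP; ring.
Qed.

Lemma normc_phase (x : R) : normc (cexp (- 'i * x%:C)) = 1.
Proof. by rewrite normc_cexp ReM /= !(mulr0, oppr0, mul0r, subr0) expR0. Qed.

Context (a b c d e mu : R) (hb : b != 0) (hmu : - (1 / 2) <= mu).
Context (f : R -> R[i]) (hf1 : in_Lmu mu 1 f) (hf2 : in_Lmu mu 2 f).

Let al := mu + 1.
Let beta := - b^-1.

Let hal : 1 / 2 <= al. Proof. by move: hmu; rewrite /al; lra. Qed.
Let beta0 : beta != 0. Proof. by rewrite oppr_eq0 invr_eq0. Qed.

Let chirp v : R[i] := cexp (- 'i * (a * v ^+ 2 + d * v)%:C) * f v.
Let f1 v := Re (chirp v).
Let f2 v := Im (chirp v).

Let normc_chirp v : normc (chirp v) = normc (f v).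
Proof. by rewrite Normc.normcM normc_phase mul1r. Qed.

Let mchirp : cmeasurable chirp.
Proof.
apply: cmeasurableM hf1.1; apply: cmeasurable_phase.
apply: measurable_funD; apply: measurable_funM => //.
Qed.

Let f1L : L1L2 al f1.
Proof.
apply: in_Lmu_L1L2 hf1 hf2 _ _; first exact: mchirp.1.
by move=> v; rewrite -normc_chirp Re_le_normc.
Qed.

Let f2L : L1L2 al f2.
Proof.
apply: in_Lmu_L1L2 hf1 hf2 _ _; first exact: mchirp.2.
by move=> v; rewrite -normc_chirp Im_le_normc.
Qed.

Let prefactor : R[i] := (c_mu mu)%:C / cpow ('i * b%:C) (mu + 1)%:C.
Let phase w : R[i] := cexp (- 'i * (c * w ^+ 2 + e * w)%:C).
Let X w := even_transform al beta f1 w - odd_transform al beta f2 w.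
Let Y w := even_transform al beta f2 w + odd_transform al beta f1 w.

(** The chirp in [v] is absorbed into [f], and the one in [w] leaves the integral. *)
Let transformE w : qpd_transform a b c d e mu f w =
  prefactor * (phase w * (Gamma al)%:C * (X w +i* Y w)).
Proof.
rewrite /qpd_transform -/prefactor; congr (_ * _).
pose F v := ((even_kernel al (beta * w * v) * f1 v -
              odd_kernel al (beta * w * v) * f2 v) * weight al v) +i*
            ((even_kernel al (beta * w * v) * f2 v +
              odd_kernel al (beta * w * v) * f1 v) * weight al v).
have i1 := weighted_integrable_even_kernel hal beta w f1L; have i2 := weighted_integrable_even_kernel hal beta w f2L.
have j1 := weighted_integrable_odd_kernel hal beta w f1L; have j2 := weighted_integrable_odd_kernel hal beta w f2L.
have j2N := weighted_integrableZ (-1) j2.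
transitivity (cintegral (fun v => phase w * (Gamma al)%:C * F v)).
  congr cintegral; apply/funext => v.
  rewrite /qpd_kernel (dunkl_kernelE _ _ hmu) weight_muE -/al.
  have -> : - w / b * v = beta * w * v by rewrite /beta; ring.
  have -> : a * v ^+ 2 + c * w ^+ 2 + d * v + e * w =
    (c * w ^+ 2 + e * w) + (a * v ^+ 2 + d * v) by ring.
  rewrite cexpD_phase -/(phase w) /F.
  have -> : f1 v = Re (cexp (- 'i * (a * v ^+ 2 + d * v)%:C) * f v) by [].
  have -> : f2 v = Im (cexp (- 'i * (a * v ^+ 2 + d * v)%:C) * f v) by [].
  set E := even_kernel _ _; set O := odd_kernel _ _; set W := weight _ _.
  set p := phase w; set q := cexp _; set y := f v; set G := Gamma al.
  move: E O W p q y G => E O W p q y G.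
  apply/eqP; rewrite eq_complex !(ReD, ImD, ReM, ImM) /=.
  by apply/andP; split; apply/eqP; ring.
rewrite cintegralZ.
- congr (_ * _); apply/eqP; rewrite eq_complex /cintegral /=; apply/andP; split; apply/eqP.
    rewrite /X /even_transform /odd_transform -[- weighted_integral _ _]mulN1r -(weighted_integralZ _ j2) -weighted_integralD//.
    by apply: eq_Rintegral => v _; rewrite mulN1r.
  by rewrite /Y /even_transform /odd_transform -weighted_integralD.
- have := weighted_integrableD i1 j2N; congr (is_true (integrable _ _ _)).
  by apply/funext => v /=; rewrite mulN1r.
- exact: weighted_integrableD i2 j1.
Qed.

(** Both sides are [(2 * `|b|) `^ (- al)]. *)
Let normc_prefactor : normc prefactor * Gamma al = hartley_const al beta.
Proof.
have al0 : 0 < al by move: hal; lra.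
have G0 := Gamma_gt0 al0.
have ib0 : 'i * b%:C != 0 :> R[i].
  by apply/eqP => h; have := normc_imaginary b; rewrite h Normc.normc0 => /esym/eqP; rewrite normr_eq0 (negbTE hb).
rewrite Normc.normcM Normc.normcV normc_cpow// normc_imaginary -/al.
rewrite /= expr0n addr0 sqrtr_sqr /c_mu -/al.
have p2 : 0 < (2 : R) `^ al by exact: powR_gt0.
have bp : 0 < `|b| `^ al by rewrite powR_gt0// normr_gt0.
rewrite ger0_norm; last by rewrite divr_ge0// mulr_ge0// ltW.
rewrite /hartley_const /beta normrN normfV.
have -> : `|b|^-1 / 2 = (`|b| * 2)^-1 by rewrite invfM.
have inv (y : R) : 0 <= y -> y^-1 `^ al = (y `^ al)^-1.
  by move=> y0; rewrite -powR_inv1// -powRrM mulN1r powRN.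
rewrite inv ?mulr_ge0// powRM//.
by field; rewrite !gt_eqF.
Qed.

Let transform_sqr w :
  Re (qpd_transform a b c d e mu f w) ^+ 2 + Im (qpd_transform a b c d e mu f w) ^+ 2 =
  hartley_const al beta ^+ 2 * (X w ^+ 2 + Y w ^+ 2).
Proof.
rewrite -normc_sqr transformE -normc_prefactor.
rewrite (Normc.normcM prefactor) (Normc.normcM (phase w * _)) (Normc.normcM (phase w)).
have -> : normc (phase w) = 1 by exact: normc_phase.
rewrite mul1r !exprMn [normc (X w +i* Y w) ^+ 2]normc_sqr.
have -> : normc (Gamma al)%:C ^+ 2 = Gamma al ^+ 2.
  by rewrite normc_sqr /= expr0n addr0.
by rewrite mulrA.
Qed.

Let transform_measurable : cmeasurable (qpd_transform a b c d e mu f).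
Proof.
rewrite (_ : qpd_transform _ _ _ _ _ _ _ =
    fun w => prefactor * (phase w * (Gamma al)%:C * (X w +i* Y w))); last first.
  by apply/funext => w; exact: transformE.
have cst (z : R[i]) : cmeasurable (fun _ : R => z) by split; exact: measurable_cst.
apply: cmeasurableM; first exact: cst.
apply: cmeasurableM.
  apply: cmeasurableM; last exact: cst.
  by apply: cmeasurable_phase; apply: measurable_funD; apply: measurable_funM.
split => /=.
  exact: measurable_funB (measurable_even_transform hal beta0 f1L)
    (measurable_odd_transform hal beta0 f2L).
exact: measurable_funD (measurable_even_transform hal beta0 f2L)
  (measurable_odd_transform hal beta0 f1L).
Qed.

Lemma qpd_plancherel :
  in_Lmu mu 2 (qpd_transform a b c d e mu f) /\
  Lmu_norm mu 2 (qpd_transform a b c d e mu f) = Lmu_norm mu 2 f.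
Proof.
suff h : Lmu_norm mu 2 (qpd_transform a b c d e mu f) = Lmu_norm mu 2 f.
  split; last exact: h.
  by split; [exact: transform_measurable|rewrite h; exact: hf2.2].
have [iT eT] := complex_plancherel hal beta0 f1L f2L.
have fE v : f1 v ^+ 2 + f2 v ^+ 2 = Re (f v) ^+ 2 + Im (f v) ^+ 2.
  by rewrite -!normc_sqr normc_chirp.
have if12 : weighted_integrable al (fun v => f1 v ^+ 2 + f2 v ^+ 2).
  by apply: weighted_integrableD; exact: L1L2_integrable_sqr.
rewrite !Lmu_norm2E.
- congr (_%:E `^ _)%E; rewrite (eq_weighted_integral _ transform_sqr) -(eq_weighted_integral _ fE).
  exact: eT.
- exact: eq_weighted_integrable fE if12.
- by apply: eq_weighted_integrable iT => w; rewrite transform_sqr.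
Qed.

End quadratic_phase.

Theorem theorem3p9 (R : realType) (a b c d e mu : R) (hb : b != 0)
    (hmu : - (1 / 2) <= mu) (f : R -> R[i])
    (hf1 : in_Lmu mu 1 f) (hf2 : in_Lmu mu 2 f) :
  in_Lmu mu 2 (qpd_transform a b c d e mu f) /\
  Lmu_norm mu 2 (qpd_transform a b c d e mu f) = Lmu_norm mu 2 f.
Proof. exact: qpd_plancherel. Qed.
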